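(* Let $\gamma^*>0$ satisfy $$E\left[\max\left(W_n^*(\gamma^* )-\tfrac T2\gamma^*,\,0\right)\right]=\frac{\tau\gamma^*}{2p_s},$$ where $W^*_n(\gamma)=W^*(\gamma;f(n))$. Suppose the sub-layer follows the rule $M^*(\gamma^* )$. Then an optimal main-layer stopping rule to maximize the average system throughput is $$N^*=\min\left\{n\ge1: W_n^*(\gamma^* )\ge\tfrac T2\gamma^*\right\};$$ that is, $N^*$ attains $$\sup_N\frac{E\left\{\overline Y_{\gamma^*}(f(N))\right\}}{E\left\{\overline T_{\gamma^*}(f(N))+T_N\right\}},$$ the supremum being over all main-layer stopping rules $N$.
   Context: Let $K,L\ge1$ be integers, $T,\tau,P_s,P_r,\sigma_f^2,\sigma_g^2>0$ constants, $p_0,p_1\in(0,1)$, $p_s=Kp_0(1-p_0)^{K-1}$, $p_r=Lp_1(1-p_1)^{L-1}$. Sub-layer problem (for fixed $f=(f_1,\dots,f_L)\in\mathbb{C}^L$). For $m=1,2,\dots$: $s(m)$ is uniform on $\{1,\dots,L\}$; $K'_m$ is geometric with $\mathrm{Prob}(K'_m=k)=p_r(1-p_r)^{k-1}$, $k\ge1$; $g_1(m),\dots,g_L(m)$ are (circularly symmetric) complex Gaussian with mean zero and variance $\sigma_g^2$; all mutually independent. Put $$R_m^f=\log_2\left(1+\frac{P_sP_r|f_{s(m)}|^2|g_{s(m)}(m)|^2}{1+P_s|f_{s(m)}|^2+P_r|g_{s(m)}(m)|^2}\right),\quad Y^f_m=\tfrac T2R^f_m,\quad T'_m=\tfrac T2+\tfrac\tau2\sum_{i=1}^mK'_i.$$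 For $\gamma>0$ let $W^*(\gamma;f)$ be the maximal expected reward $\sup_ME(Y^f_M-\gamma T'_M)$ over stopping times $M\ge1$ (with respect to the filtration generated by $(s(m),K'_m,g_{s(m)}(m))$) with $E(T'_M)<\infty$; it is the unique root $w$ of $E[\max(\frac T2R^f_m-\frac T2\gamma,w)]=w+\frac{\gamma\tau}{2p_r}$. Let $M^*(\gamma)=\min\{m\ge1:\frac T2R^f_m\ge W^*(\gamma;f)+\frac T2\gamma\}$, and let $\overline Y_\gamma(f)=E(Y^f_{M^*(\gamma)})$ and $\overline T_\gamma(f)=E(T'_{M^*(\gamma)})$. Main layer. For $n=1,2,\dots$: $s(n)$ is uniform on $\{1,\dots,K\}$; $K_n$ is geometric with $\mathrm{Prob}(K_n=k)=p_s(1-p_s)^{k-1}$, $k\ge1$; the gains $f_{ij}(n)$ ($1\le i\le K,1\le j\le L$) are (circularly symmetric) complex Gaussian with mean zero and variance $\sigma_f^2$; all mutually independent within and across observations. Write $f(n)=(f_{s(n)1}(n),\dots,f_{s(n)L}(n))$ and $T_n=\frac T2+\frac\tau2\sum_{i=1}^nK_i$. A main-layer stopping rule is a stopping time $N$ with values in $\{1,2,\dots\}$ with respect to the filtration generated by $(s(n),K_n,f(n))$, $n\ge1$, with $E\{\overline T_{\gamma^*}(f(N))+T_N\}<\infty$. *)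

(* Defs.v *)
From HB Require Import structures.
From mathcomp Require Import all_boot all_order all_algebra.
From mathcomp Require Export finmap complex.
From mathcomp Require Import all_classical all_reals all_analysis.

Set Implicit Arguments.
Unset Strict Implicit.
Unset Printing Implicit Defensive.
Import Order.TTheory GRing.Theory Num.Theory.
Import ComplexField.Normc.

Local Open Scope classical_set_scope.
Local Open Scope ring_scope.

(* Time convention: all processes are indexed from 0, so that index [n] stands
   for the [n.+1]-st observation; stopping at [Some n] means stopping after
   [n.+1] observations, and [None] is the value infinity. *)

Section probability_notions.
Context {R : realType}.

Definition re_im (z : R[i]) : R * R := (complex.Re z, complex.Im z).

(* sigma(X) for X with values in a discrete space *)
Definition discrete_events {Omega A : Type} (X : Omega -> A) : set_system Omega :=
  preimage_set_system setT X discrete_measurable.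

(* sigma(Z) for Z complex-valued, C being identified with R^2 *)
Definition complex_events {Omega : Type} (Z : Omega -> R[i]) : set_system Omega :=
  preimage_set_system setT (re_im \o Z) measurable.

Context {d : measure_display} {Omega : measurableType d}.
Variable P : probability Omega R.

Definition mutually_independent {I : choiceType} (F : I -> set_system Omega) :=
  forall (J : {fset I}) (A : I -> set Omega),
    (forall i, i \in J -> F i (A i)) ->
    P (\bigcap_(i in [set` J]) A i) = (\prod_(i <- J) P (A i))%E.

(* Circularly symmetric: the real and imaginary parts are independent, each
   normal with mean 0 and variance v / 2, so that E|Z|^2 = v
   (the second parameter of [normal_prob] is the standard deviation). *)
Definition complex_gaussian (v : R) (Z : Omega -> R[i]) : Prop :=
  measurable_fun setT (re_im \o Z) /\
  forall A : set (R * R), measurable A ->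
    P ((re_im \o Z) @^-1` A) =
    (normal_prob 0 (Num.sqrt (v / 2)) \x normal_prob 0 (Num.sqrt (v / 2)))%E A.

Definition uniform_ord (u : nat) (X : Omega -> 'I_u) : Prop :=
  forall i, measurable (X @^-1` [set i]) /\ P (X @^-1` [set i]) = (u%:R^-1)%:E.

Definition geometric (p : R) (X : Omega -> nat) : Prop :=
  measurable_fun setT X /\
  forall k, (0 < k)%N -> P (X @^-1` [set k]) = (p * (1 - p) ^+ k.-1)%:E.

(* One layer of the random access protocol: at observation [n], [s n] is the
   index of the winner among [u] contenders, [k n] the number of contention
   slots used, and [h n i] the channel gains. *)
Record contention_layer (u : nat) (I : finType) (p v : R)
    (s : nat -> Omega -> 'I_u) (k : nat -> Omega -> nat)
    (h : nat -> I -> Omega -> R[i]) : Prop := {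
  layer_uniform : forall n, uniform_ord (s n);
  layer_geometric : forall n, geometric p (k n);
  layer_gaussian : forall n i, complex_gaussian v (h n i);
  layer_independent :
    mutually_independent (fun x : nat + nat + nat * I =>
      match x with
      | inl (inl n) => discrete_events (s n)
      | inl (inr n) => discrete_events (k n)
      | inr (n, i) => complex_events (h n i)
      end)
}.

End probability_notions.

Section stopping.
Context {R : realType} {Omega : Type}.

(* The filtration generated by the observations (s n, k n, (h n j)_j). *)
Definition observed_filtration (u : nat) (J : Type)
    (s : nat -> Omega -> 'I_u) (k : nat -> Omega -> nat)
    (h : nat -> J -> Omega -> R[i]) (n : nat) : set_system Omega :=
  <<s \bigcup_(m in `I_n.+1)
        (discrete_events (s m) `|` discrete_events (k m) `|`
         \bigcup_j complex_events (h m j)) >>.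

Definition stopping_time (F : nat -> set_system Omega)
    (tau : Omega -> option nat) : Prop :=
  forall n, F n (tau @^-1` [set Some n]).

Definition first_time (p : pred nat) : option nat :=
  match pselect (exists n, p n) with
  | left h => Some (ex_minn h)
  | right _ => None
  end.

(* X_t, with the value [xoo] at t = infinity *)
Definition at_time (xoo : \bar R) (X : nat -> \bar R) (t : option nat) : \bar R :=
  if t is Some n then X n else xoo.

(* time elapsed after the observation of index [n] (thus [n.+1] observations) *)
Definition elapsed (T tau : R) (k : nat -> Omega -> nat) (n : nat) (w : Omega) : R :=
  T / 2 + tau / 2 * \sum_(i < n.+1) (k i w)%:R.

End stopping.

Section system.
Context {R : realType}.

(* probability that exactly one of [u] contenders transmits in a slot *)
Definition success_prob (u : nat) (p : R) : R := u%:R * p * (1 - p) ^+ u.-1.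

Definition log2 (x : R) : R := ln x / ln 2.

Definition rate (Ps Pr : R) (z w : R[i]) : R :=
  log2 (1 + Ps * Pr * normc z ^+ 2 * normc w ^+ 2 /
            (1 + Ps * normc z ^+ 2 + Pr * normc w ^+ 2)).

Variables (T tau Ps Pr : R) (L : nat).

Section sublayer.
Context {d : measure_display} {Omega : measurableType d}.
Variables (Q : probability Omega R) (s : nat -> Omega -> 'I_L)
  (k : nat -> Omega -> nat) (g : nat -> 'I_L -> Omega -> R[i]).
Variables (gamma : R) (z : 'I_L -> R[i]).

Definition sub_rate (m : nat) (w : Omega) : R :=
  rate Ps Pr (z (s m w)) (g m (s m w) w).

Definition sub_reward (m : nat) (w : Omega) : R := T / 2 * sub_rate m w.

Definition sub_filtration : nat -> set_system Omega :=
  observed_filtration s k (fun m (_ : unit) w => g m (s m w) w).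

Definition expected_sub_reward (M : Omega -> option nat) : \bar R :=
  (\int[Q]_w at_time 0 (fun m => (sub_reward m w)%:E) (M w))%E.

Definition expected_sub_time (M : Omega -> option nat) : \bar R :=
  (\int[Q]_w at_time +oo (fun m => (elapsed T tau k m w)%:E) (M w))%E.

Definition expected_sub_gain (M : Omega -> option nat) : \bar R :=
  (\int[Q]_w (at_time 0 (fun m => (sub_reward m w)%:E) (M w) -
     gamma%:E * at_time +oo (fun m => (elapsed T tau k m w)%:E) (M w)))%E.

(* M may be infinite with probability 0 only, the time being +oo there. *)
Definition sub_rule (M : Omega -> option nat) : Prop :=
  stopping_time sub_filtration M /\ (expected_sub_time M < +oo)%E.

Definition Wstar : \bar R :=
  ereal_sup [set expected_sub_gain M | M in sub_rule].

Definition Mstar (w : Omega) : option nat :=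
  first_time (fun m => (Wstar + (T / 2 * gamma)%:E <= (sub_reward m w)%:E)%E).

Definition Ybar : \bar R := expected_sub_reward Mstar.

Definition Tbar : \bar R := expected_sub_time Mstar.

End sublayer.

Section mainlayer.
Context {d : measure_display} {Omega : measurableType d}.
Variables (K : nat) (P : probability Omega R) (s : nat -> Omega -> 'I_K)
  (k : nat -> Omega -> nat) (f : nat -> 'I_K * 'I_L -> Omega -> R[i]).

Definition winner_gains (n : nat) (w : Omega) (j : 'I_L) : R[i] :=
  f n (s n w, j) w.

Definition main_filtration : nat -> set_system Omega :=
  observed_filtration s k (fun n j w => winner_gains n w j).

(* reward and duration brought by the sub-layer, as functions of the gains *)
Variables (Y D : ('I_L -> R[i]) -> \bar R).

Definition expected_main_reward (N : Omega -> option nat) : \bar R :=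
  (\int[P]_w at_time 0 (fun n => Y (winner_gains n w)) (N w))%E.

Definition expected_main_time (N : Omega -> option nat) : \bar R :=
  (\int[P]_w at_time +oo
     (fun n => D (winner_gains n w) + (elapsed T tau k n w)%:E) (N w))%E.

(* N may be infinite with probability 0 only, the time being +oo there. *)
Definition main_rule (N : Omega -> option nat) : Prop :=
  stopping_time main_filtration N /\ (expected_main_time N < +oo)%E.

Definition throughput (N : Omega -> option nat) : \bar R :=
  (expected_main_reward N / expected_main_time N)%E.

End mainlayer.

End system.

(* Main.v *)
(** Both layers are search problems without recall, with i.i.d. observations that
    cost time; time is priced at the rate gamma.  If V n is the excess of the n-th
    reward over a reservation value and k n the cost of the n-th observation, then
    the reward on stopping at N exceeds the reservation value by at most
    \sum_(n <= N) V n, with equality when N is the first time at which the reservation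
    value is reached.  By Wald's identity the sums of V and of k have the same mean
    as soon as V n and k n have; the reservation values of both layers are chosen
    so that they do.  In the sub-layer this identifies W^* as the root of its
    equation and gives E Y - gamma E T' = W^* for the rule M^*.  In the main layer
    it gives E Y <= gamma E T for every rule, with equality for N^*, so that gamma
    is the optimal throughput.  N^* has finite mean duration because the rewards
    are dominated by the moduli of the Gaussian gains: their second moments bound
    the probability of stopping from below, uniformly in time, and the mean reward
    at N^*, hence gamma times the mean duration, from above. *)

Require Import Defs.
From HB Require Import structures.
From mathcomp Require Import all_boot all_order all_algebra.
From mathcomp Require Import all_classical all_reals all_analysis.
From mathcomp Require Import measurable_realfun.
From mathcomp Require Import ring lra.

Set Implicit Arguments.
Unset Strict Implicit.
Unset Printing Implicit Defensive.
Import Order.TTheory GRing.Theory Num.Theory.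
Import numFieldNormedType.Exports.

Local Open Scope classical_set_scope.
Local Open Scope ring_scope.

(** * Independence of generated sigma-algebras *)

Section independence.
Context {R : realType} {d : measure_display} {Omega : measurableType d}.
Variable P : probability Omega R.

(** Two obstacles shape the argument. The first is integrability: that a threshold rule has finite
    mean duration must itself be proved. Identities are therefore set up in [\bar R] between
    nonnegative quantities, where Tonelli gives Wald's identity even for infinite means, and
    finiteness is read off afterwards. The reservation value of the sub-layer, of unknown sign, is
    split into positive and negative parts for this reason. The second is measurability: [Wstar] is
    a supremum over a huge family of rules and has no evident measurable dependence on the
    main-layer gains. Once it is identified with the root of a mean that is strictly monotone at the
    relevant level, its superlevel sets become those of an integral with a parameter, to which
    Fubini-Tonelli applies; [Tbar] is treated alike. Independence also needs care: observed gains
    sit at the random index [s n] and are not among the independent families, so all variables of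
    one time are grouped into a block. *)

Definition independent_events (A B : set Omega) : Prop :=
  P (A `&` B) = (P A * P B)%E.

Lemma independent_eventsC A B :
  independent_events A B -> independent_events B A.
Proof. by rewrite /independent_events setIC muleC. Qed.

(** Dynkin's pi-lambda argument: the measurable events independent of a fixed [B] form a
    lambda-system. Finiteness of [P] justifies the subtraction for proper differences. *)
Lemma independent_events_salgebra (G : set_system Omega) (B : set Omega) :
  setI_closed G -> G `<=` measurable -> measurable B ->
  (forall A, G A -> independent_events A B) ->
  forall A, <<s G >> A -> independent_events A B.
Proof.
move=> GI Gm mB GB.
pose H := [set A | measurable A /\ independent_events A B].
suff GH : <<s G >> `<=` H by move=> A /GH[].
apply: lambda_system_subset => //; last by move=> A GA; split; [exact: Gm|exact: GB].
split => //.
- by split=> //; rewrite /independent_events setTI probability_setT mul1e.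
- move=> A1 A2 A21 [mA1 i1] [mA2 i2]; split; first exact: measurableD.
  rewrite /independent_events.
  have -> : (A1 `\` A2) `&` B = (A1 `&` B) `\` (A2 `&` B).
    by apply/seteqP; split => x /=; tauto.
  have Pfin C : measurable C -> (P C < +oo)%E.
    by move=> mC; rewrite -ge0_fin_numE// fin_num_measure.
  have A21B : (A1 `&` B) `&` (A2 `&` B) = A2 `&` B.
    by apply/seteqP; split => x /=; [tauto|move=> [/[dup] /A21]].
  have mA1B : measurable (A1 `&` B) by exact: measurableI.
  have mA2B : measurable (A2 `&` B) by exact: measurableI.
  have -> : P ((A1 `&` B) `\` (A2 `&` B)) = (P (A1 `&` B) - P (A2 `&` B))%E.
    by rewrite -[in RHS]A21B; exact: (measureD mA1B mA2B (Pfin _ mA1B)).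
  have -> : P (A1 `\` A2) = (P A1 - P A2)%E.
    by rewrite -[in RHS](setIidr A21); exact: (measureD mA1 mA2 (Pfin _ mA1)).
  rewrite i1 i2.
  by rewrite muleBl ?fin_num_measure// fin_num_adde_defr ?fin_num_measure.
- move=> A ndA mA; split; first by apply: bigcupT_measurable => i; have [] := mA i.
  have mAi i : measurable (A i) by have [] := mA i.
  rewrite /independent_events setI_bigcupl.
  have h1 : P (A n `&` B) @[n --> \oo] --> P (\bigcup_i (A i `&` B)).
    apply: nondecreasing_cvg_mu.
    - by move=> i; exact: measurableI.
    - by apply: bigcupT_measurable => i; exact: measurableI.
    - by move=> i j /ndA/subsetPset AA; apply/subsetPset; exact: setSI.
  have h2 : (P (A n) * P B)%E @[n --> \oo] --> (P (\bigcup_i A i) * P B)%E.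
    apply: cvgeZr; first exact: fin_num_measure.
    by apply: nondecreasing_cvg_mu => //; exact: bigcupT_measurable.
  apply: (cvg_unique _ h1); first exact: ereal_hausdorff.
  rewrite /= (_ : (fun n => P (A n `&` B)) = fun n => (P (A n) * P B)%E)//.
  by apply/funext => n; have [_ ->] := mA n.
Qed.

(** Finite intersections of events of one group form a pi-system; disjointness of the groups makes
    the product over the union of two index sets factor. The pi-lambda step then enlarges one side
    at a time. *)
Lemma mutually_independent_group (I : choiceType) (F : I -> set_system Omega)
    (J1 J2 : set I) :
  (forall i, setI_closed (F i)) -> (forall i, F i setT) ->
  (forall i, F i `<=` measurable) ->
  mutually_independent P F -> J1 `&` J2 = set0 ->
  forall A B, <<s \bigcup_(i in J1) F i >> A -> <<s \bigcup_(i in J2) F i >> B ->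
  independent_events A B.
Proof.
move=> FI FT Fm indF J12.
pose Pi (J : set I) := [set A : set Omega | exists (K : {fset I}) (C : I -> set Omega),
   [/\ [set` K] `<=` J, forall i, i \in K -> F i (C i) &
       A = \bigcap_(i in [set` K]) C i]].
have PiI J : setI_closed (Pi J).
  move=> A B [K1 [C1 [K1J F1 ->]]] [K2 [C2 [K2J F2 ->]]].
  (* Padding with [setT] puts both intersections over a common index set. *)
  exists (K1 `|` K2)%fset, (fun i => (if i \in K1 then C1 i else setT) `&`
    (if i \in K2 then C2 i else setT)); split.
  - by move=> i /=; rewrite in_fsetU => /orP[/K1J|/K2J].
  - move=> i _; apply: FI; case: ifP => [iK|_]; [exact: F1|exact: FT|exact: F2|exact: FT].
  - apply/seteqP; split => [x [h1 h2] i _|x h].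
      by split; case: ifP => // iK; [exact: h1|exact: h2].
    split=> i /= iK; have [|h1 h2] := h i; rewrite /= ?in_fsetU ?iK ?orbT//.
      by move: h1; rewrite iK.
    by move: h2; rewrite iK.
have Pim J : Pi J `<=` measurable.
  move=> _ [K [C [_ FC ->]]]; apply: fin_bigcap_measurable => // i iK.
  exact/Fm/FC.
have FPi J : <<s \bigcup_(i in J) F i >> `<=` <<s Pi J >>.
  apply: sub_sigma_algebra2 => A [i Ji FA]; exists [fset i]%fset, (fun=> A); split.
  - by move=> j /=; rewrite in_fset1 => /eqP ->.
  - by move=> j; rewrite in_fset1 => /eqP ->.
  - apply/seteqP; split => [x Ax j //|x /(_ i)]; apply.
    by rewrite /= in_fset1.
have mPi J : <<s Pi J >> `<=` measurable.
  by apply: smallest_sub; [exact: sigma_algebra_measurable|exact: Pim].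
have base A B : Pi J1 A -> Pi J2 B -> independent_events A B.
  move=> [K1 [C1 [K1J F1 ->]]] [K2 [C2 [K2J F2 ->]]].
  have dis : [disjoint K1 & K2]%fset.
    apply/fdisjointP => i iK1; apply/negP => iK2.
    have : (J1 `&` J2) i by split; [exact: K1J|exact: K2J].
    by rewrite J12.
  pose C i := if i \in K1 then C1 i else C2 i.
  have CK2 i : i \in K2 -> C i = C2 i.
    move=> iK2; rewrite /C ifF//; apply/negbTE/negP => iK1.
    by move/fdisjointP : dis => /(_ _ iK1); rewrite iK2.
  have e1 : \bigcap_(i in [set` K1]) C1 i = \bigcap_(i in [set` K1]) C i.
    by apply: eq_bigcapr => i /= iK; rewrite /C iK.
  have e2 : \bigcap_(i in [set` K2]) C2 i = \bigcap_(i in [set` K2]) C i.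
    by apply: eq_bigcapr => i /= /CK2.
  have e12 : \bigcap_(i in [set` K1]) C i `&` \bigcap_(i in [set` K2]) C i =
      \bigcap_(i in [set` (K1 `|` K2)%fset]) C i.
    by rewrite set_fsetU bigcap_setU.
  rewrite /independent_events e1 e2 e12 !indF.
  - rewrite -big_cat; apply: perm_big; apply: uniq_perm => //.
      rewrite cat_uniq !fset_uniq andbT; apply/hasPn => i iK2.
      by apply/negP => iK1; move/fdisjointP : dis => /(_ _ iK1); rewrite iK2.
    by move=> i; rewrite mem_cat in_fsetU.
  - by move=> i /[dup] iK /CK2 ->; exact: F2.
  - by move=> i iK; rewrite /C iK; exact: F1.
  - move=> i; rewrite in_fsetU => /orP[iK|/[dup] iK /CK2 ->]; last exact: F2.
    by rewrite /C iK; exact: F1.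
move=> A B /FPi sA /FPi sB.
apply: (@independent_events_salgebra (Pi J1)) => //; first exact: mPi sB.
move=> {sA}A PA; apply: independent_eventsC.
apply: (@independent_events_salgebra (Pi J2)) => //; first exact: Pim PA.
by move=> {sB}B PB; apply: independent_eventsC; exact: base.
Qed.

(** The law of [V] under [P] restricted to [A] is [P A] times its law under [P], so this is a change
    of variables; [V] may have infinite mean. *)
Lemma independent_integral (A : set Omega) (V : Omega -> \bar R) :
  measurable A -> measurable_fun setT V -> (forall w, 0 <= V w)%E ->
  (forall U, measurable U -> independent_events A (V @^-1` U)) ->
  (\int[P]_(w in A) V w = P A * \int[P]_w V w)%E.
Proof.
move=> mA mV V0 AV.
have PA : P A \is a fin_num by exact: fin_num_measure.
have PA0 : 0 <= fine (P A) by exact: fine_ge0.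
(* maxe y 0 extends the identity of [0, +oo] to a nonnegative function on \bar R *)
have mid : measurable_fun setT (fun y : \bar R => maxe y 0)%E.
  by apply: measurable_maxe.
have id0 (y : \bar R) : (0 <= maxe y 0)%E by rewrite le_max lexx orbT.
have E (mu : measure Omega R) :
    (\int[pushforward mu V]_y (maxe y 0) = \int[mu]_w V w)%E.
  rewrite ge0_integral_pushforward//=; apply: eq_integral => w _ /=.
  by apply/max_idPl.
have -> : (\int[P]_(w in A) V w = \int[mrestr P mA]_w V w)%E.
  rewrite [RHS](@ge0_negligible_integral _ _ _ _ _ (~` A))//=; last 2 first.
    exact: measurableC.
    by rewrite /mrestr setICl measure0.
  rewrite setTD setCK; apply: eq_measure_integral => U mU UA.
  by rewrite /= /mrestr setIidl.
rewrite -!E -[in RHS](fineK PA).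
rewrite -(ge0_integral_mscale _ _ (NngNum PA0))//.
apply: eq_measure_integral => U mU _.
change (P (V @^-1` U `&` A) = (fine (P A))%:E * P (V @^-1` U))%E.
by rewrite setIC AV// fineK.
Qed.

End independence.

(** * Stopped sums and optimal search *)

Section stopped_sequences.
Context {R : realType} {d : measure_display} {Omega : measurableType d}.
Variable P : probability Omega R.
Implicit Types (N : Omega -> option nat) (V X : nat -> Omega -> \bar R).

Lemma sub_measurable_fun {d'} {Y : measurableType d'} (G : set_system Omega)
    (f : Omega -> Y) : <<s G >> `<=` measurable ->
  measurable_fun (T := g_sigma_algebraType G) setT f -> measurable_fun setT f.
Proof. by move=> Gm mf _ U mU; by apply: Gm; exact: mf. Qed.

Lemma measurable_stop_None N : (forall n, measurable (N @^-1` [set Some n])) ->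
  measurable (N @^-1` [set None]).
Proof.
move=> mN; rewrite (_ : _ @^-1` _ = ~` \bigcup_n N @^-1` [set Some n]).
  by apply: measurableC; exact: bigcupT_measurable.
apply/seteqP; split => [w /= Nw [n _ /=]|w /= NN]; first by rewrite Nw.
by case Nw : (N w) => [n|]//; exfalso; apply: NN; exists n.
Qed.

Lemma measurable_at_time (xoo : \bar R) X N :
  (forall n, measurable_fun setT (X n)) ->
  (forall n, measurable (N @^-1` [set Some n])) ->
  measurable_fun setT (fun w => at_time xoo (X ^~ w) (N w)).
Proof.
move=> mX mN _ U mU; rewrite setTI.
have mNone := measurable_stop_None mN.
have -> : (fun w => at_time xoo (X ^~ w) (N w)) @^-1` U =
    \bigcup_n (N @^-1` [set Some n] `&` (X n @^-1` U)) `|`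
    (N @^-1` [set None] `&` [set _ | U xoo]).
  apply/seteqP; split => [w /=|w [[n _ [/= ->]]|[/= ->]]]//.
  by case Nw : (N w) => [n|] /= Un; [left; exists n|right].
apply: measurableU.
  apply: bigcupT_measurable => n; apply: measurableI => //.
  by rewrite -[X in measurable X]setTI; exact: mX.
apply: measurableI => //; have [Uoo|Uoo] := pselect (U xoo).
  by rewrite (_ : [set _ | _] = setT)//; apply/seteqP; split.
by rewrite (_ : [set _ | _] = set0)//; apply/seteqP; split.
Qed.

Lemma first_time_some (p : pred nat) n :
  first_time p = Some n <-> p n /\ forall m, (m < n)%N -> ~~ p m.
Proof.
rewrite /first_time; case: pselect => [h|h]; last first.
  by split => // -[pn _]; exfalso; apply: h; exists n.
case: ex_minnP => i pi imin; split => [[<-]|[pn nmin]].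
  by split=> // m mi; apply/negP => /imin; rewrite leqNgt mi.
congr Some; apply/eqP; rewrite eqn_leq imin//= leqNgt.
by apply/negP => /nmin; rewrite pi.
Qed.

Lemma measurable_first_time (E : nat -> Omega -> bool) n :
  (forall m, measurable [set w | E m w]) ->
  measurable ((fun w => first_time (E ^~ w)) @^-1` [set Some n]).
Proof.
move=> mE; rewrite (_ : _ @^-1` _ =
    [set w | E n w] `&` \bigcap_(m in `I_n) ~` [set w | E m w]).
  apply: measurableI => //; apply: fin_bigcap_measurable => // m _.
  exact: measurableC.
apply/seteqP; split => w /=.
  by move=> /first_time_some[En Em]; split=> // m mn; apply/negP; exact: Em.
by move=> [En Em]; apply/first_time_some; split=> // m mn; apply/negP; exact: Em.
Qed.

(* The event that at least n.+1 observations are made. *)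
Definition alive N (n : nat) : set Omega :=
  [set w | forall m, (m < n)%N -> N w <> Some m].

Lemma alive0 N : alive N 0 = setT.
Proof. by apply/seteqP; split. Qed.

Lemma aliveS N n : alive N n.+1 = alive N n `&` ~` (N @^-1` [set Some n]).
Proof.
apply/seteqP; split => [w aw|w [aw Nw] m].
  by split; [move=> m mn; apply: aw; exact: ltnW|exact: aw].
by rewrite ltnS leq_eqVlt => /predU1P[->//|/aw].
Qed.

(** The stopped sum of [V] up to and including [N], written as a series of restrictions so that sum
    and integral can be exchanged. All terms count where [N] is [None]. *)
Definition total V N (w : Omega) : \bar R :=
  (\sum_(0 <= n <oo) (V n \_ (alive N n)) w)%E.

Lemma total_at_time V N w n : (forall n w, 0 <= V n w)%E -> N w = Some n ->
  total V N w = (\sum_(i < n.+1) V i w)%E.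
Proof.
move=> V0 Nw; rewrite /total (nneseries_split 0 n.+1); last first.
  by move=> m _; exact: erestrict_ge0.
rewrite eseries0 ?adde0; last first.
  move=> m nm _; rewrite /patch memNset// => /(_ n); apply => //.
rewrite add0n big_mkord; apply: eq_bigr => i _; rewrite /patch mem_set// => m mi.
rewrite Nw => -[nm]; move: mi; rewrite -nm ltnNge.
by rewrite -ltnS ltn_ord.
Qed.

Lemma total_ge0 V N w : (forall n w, 0 <= V n w)%E -> (0 <= total V N w)%E.
Proof. by move=> V0; apply: nneseries_ge0 => n _ _; exact: erestrict_ge0. Qed.

Variable obs : nat -> set_system Omega.

Definition past (n : nat) : set_system Omega := <<s \bigcup_(m in `I_n) obs m >>.

Lemma pastS n m : (m < n)%N -> <<s obs m >> `<=` past n.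
Proof. by move=> mn; apply: sub_sigma_algebra2 => A oA; exists m. Qed.

Lemma past_le m n : (m <= n)%N -> past m `<=` past n.
Proof.
move=> mn; apply: sub_sigma_algebra2; apply: bigcup_subset => i /= im.
exact: leq_trans im mn.
Qed.

(** Predictability: whether observation [n] is made is decided by the earlier ones. Hence [past n]
    here, against [succn] in the stopping condition. *)
Lemma past_alive N n : stopping_time (past \o succn) N -> past n (alive N n).
Proof.
move=> sN; elim: n => [|n IHn]; first by rewrite alive0;
  exact: (@measurableT _ (g_sigma_algebraType _)).
rewrite aliveS; apply: (@measurableI _ (g_sigma_algebraType _)).
  exact: past_le IHn.
by apply: (@measurableC _ (g_sigma_algebraType _)); exact: sN.
Qed.

Hypothesis obs_measurable : forall n, obs n `<=` measurable.
Hypothesis obs_independent : forall n A B, past n A -> <<s obs n >> B ->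
  independent_events P A B.

Lemma past_measurable n : past n `<=` measurable.
Proof.
apply: smallest_sub; first exact: sigma_algebra_measurable.
by move=> A [m _]; exact: obs_measurable.
Qed.

Lemma s_obs_measurable n : <<s obs n >> `<=` measurable.
Proof.
by apply: smallest_sub; [exact: sigma_algebra_measurable|exact: obs_measurable].
Qed.

Definition adapted V : Prop :=
  forall n, measurable_fun (T := g_sigma_algebraType (obs n)) setT (V n).

Lemma adapted_measurable V n : adapted V -> measurable_fun setT (V n).
Proof. by move=> aV; apply: sub_measurable_fun (aV n); exact: s_obs_measurable. Qed.

Lemma stopping_measurable N n : stopping_time (past \o succn) N ->
  measurable (N @^-1` [set Some n]).
Proof. by move=> sN; apply: past_measurable; exact: sN. Qed.

Lemma alive_measurable N n : stopping_time (past \o succn) N ->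
  measurable (alive N n).
Proof. by move=> sN; apply: past_measurable; exact: past_alive. Qed.

Lemma measurable_total V N : stopping_time (past \o succn) N ->
  adapted V -> (forall n w, 0 <= V n w)%E -> measurable_fun setT (total V N).
Proof.
move=> sN aV V0; apply: ge0_emeasurable_sum => [n w _ _|n _].
  exact: erestrict_ge0.
apply/(measurable_restrictT _ (alive_measurable n sN)).
by apply: measurable_funTS; exact: adapted_measurable.
Qed.

(** Integrate the series termwise: [alive N n] lies in the past of [n], hence is independent of
    [V n]. Both sides may be [+oo]. *)
Lemma wald V N : stopping_time (past \o succn) N ->
  adapted V -> (forall n w, 0 <= V n w)%E ->
  (\int[P]_w total V N w =
   \sum_(0 <= n <oo) P (alive N n) * \int[P]_w V n w)%E.
Proof.
move=> sN aV V0; rewrite integral_nneseries//.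
- apply: eq_eseriesr => n _; rewrite -integral_mkcond.
  apply: independent_integral => //.
  + exact: alive_measurable.
  + exact: adapted_measurable.
  + move=> U mU; apply: obs_independent; first exact: past_alive.
    by rewrite -[X in <<s _ >> X]setTI; exact: aV.
- move=> n; apply/(measurable_restrictT _ (alive_measurable n sN)).
  by apply: measurable_funTS; exact: adapted_measurable.
- by move=> n w _; exact: erestrict_ge0.
Qed.

(** The stopped value is one nonnegative term of the stopped sum, or 0 where [N] is [None]. *)
Lemma le_at_time_total V N : stopping_time (past \o succn) N ->
  adapted V -> (forall n w, 0 <= V n w)%E ->
  (\int[P]_w at_time 0 (V ^~ w) (N w) <= \int[P]_w total V N w)%E.
Proof.
move=> sN aV V0; apply: ge0_le_integral => //.
- by move=> w _; case: (N w) => //= n; exact: V0.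
- apply: measurable_at_time => n; first exact: adapted_measurable.
  exact: stopping_measurable.
- exact: measurable_total.
- move=> w _; case Nw : (N w) => [n|] /=; last exact: total_ge0.
  rewrite (total_at_time V0 Nw) big_ord_recr /= leeDr//.
  by apply: sume_ge0.
Qed.

(** The integrands agree where [N] is finite; the value [+oo] covers the event [None]. *)
Lemma le_total_at_time V N : stopping_time (past \o succn) N ->
  adapted V -> (forall n w, 0 <= V n w)%E ->
  (\int[P]_w total V N w <=
   \int[P]_w at_time +oo (fun n => \sum_(i < n.+1) V i w) (N w))%E.
Proof.
move=> sN aV V0; apply: ge0_le_integral => //.
- by move=> w _; exact: total_ge0.
- exact: measurable_total.
- apply: (@measurable_at_time +oo%E (fun n w => \sum_(i < n.+1) V i w)%E) => n.
    by apply: emeasurable_sum => i; exact: adapted_measurable.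
  exact: stopping_measurable.
- move=> w _; case Nw : (N w) => [n|] /=; last exact: leey.
  by rewrite (total_at_time V0 Nw).
Qed.

(* V n is the reward in excess of a reservation value, k n the cost of observing. *)
Lemma search_bound V k N : stopping_time (past \o succn) N ->
  adapted V -> (forall n w, 0 <= V n w)%E ->
  adapted k -> (forall n w, 0 <= k n w)%E ->
  (forall n, \int[P]_w V n w = \int[P]_w k n w)%E ->
  (\int[P]_w at_time 0 (V ^~ w) (N w) <=
   \int[P]_w at_time +oo (fun n => \sum_(i < n.+1) k i w) (N w))%E.
Proof.
move=> sN aV V0 ak k0 Vk; apply: le_trans (le_at_time_total sN aV V0) _.
apply: le_trans (le_total_at_time sN ak k0).
rewrite !wald// (@eq_eseriesr _ _ (fun n => P (alive N n) * \int[P]_w k n w)%E)//.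
by move=> n _; rewrite Vk.
Qed.

(** * First entrance times with a uniformly positive chance of stopping *)

Section first_time.
Variables (E : nat -> Omega -> bool) (delta : R).
Let N w := first_time (E ^~ w).
Hypothesis obsE : forall n, <<s obs n >> [set w | E n w].
Hypothesis delta_gt0 : 0 < delta.
Hypothesis delta_le : forall n, (delta%:E <= P [set w | E n w])%E.

Lemma alive_first_time n : alive N n.+1 = alive N n `&` ~` [set w | E n w].
Proof.
have aE m w : alive N m w <-> forall i, (i < m)%N -> ~~ E i w.
  elim: m => [|m IHm]; first by split.
  rewrite aliveS; split => [[/IHm aw Nw] i|aw].
    rewrite ltnS leq_eqVlt => /predU1P[->|/aw//].
    by apply/negP => Em; apply: Nw; apply/first_time_some.
  split; first by apply/IHm => i im; apply: aw; exact: ltnW.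
  by move=> /first_time_some[Em _]; have := aw _ (ltnSn m); rewrite Em.
apply/seteqP; split => w.
  move=> /aE aw; split; first by apply/aE => i im; apply: aw; exact: ltnW.
  by apply/negP; exact: aw.
move=> [/aE aw /negP Ew]; apply/aE => i.
by rewrite ltnS leq_eqVlt => /predU1P[->//|/aw].
Qed.

Lemma stopping_first_time : stopping_time (past \o succn) N.
Proof.
(* [past_alive] presupposes a stopping time, so the recursion [alive_first_time] is used instead. *)
have pa n : past n (alive N n).
  elim: n => [|n IHn]; first by rewrite alive0; exact: (@measurableT _ (g_sigma_algebraType _)).
  rewrite alive_first_time; apply: (@measurableI _ (g_sigma_algebraType _)).
    exact: past_le IHn.
  by apply: (@measurableC _ (g_sigma_algebraType _)); exact: (pastS (ltnSn n)).
move=> n.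
have -> : N @^-1` [set Some n] = alive N n `&` [set w | E n w].
  apply/seteqP; split => w /=.
    move=> Nw; split; last by move/first_time_some : Nw => [].
    by move=> m mn; rewrite Nw => -[nm]; rewrite nm ltnn in mn.
  move=> [aw Ew]; have := (alive_first_time n); rewrite aliveS => /seteqP[h _].
  by apply: contrapT => Nw; have [] := h w.
apply: (@measurableI _ (g_sigma_algebraType _)); first exact: (past_le (leqnSn n)).
exact: (pastS (ltnSn n)).
Qed.

(** Given the past, each observation fails to trigger stopping with probability at most 1 -
    delta. *)
Lemma alive_first_time_le n : (P (alive N n) <= ((1 - delta) ^+ n)%:E)%E.
Proof.
have PE m : P [set w | E m w] \is a fin_num.
  by apply: fin_num_measure; exact: s_obs_measurable.
have d1 : 0 <= 1 - delta.
  rewrite subr_ge0 -lee_fin; apply: le_trans (delta_le 0) _.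
  by apply: probability_le1; exact: s_obs_measurable.
elim: n => [|n IHn]; first by rewrite alive0 probability_setT expr0.
have -> : P (alive N n.+1) = (P (alive N n) * P (~` [set w | E n w]))%E.
  rewrite alive_first_time; apply: (@obs_independent n).
    by apply: past_alive; exact: stopping_first_time.
  by apply: (@measurableC _ (g_sigma_algebraType _)); exact: obsE.
rewrite exprSr EFinM; apply: lee_pmul => //.
rewrite probability_setC; last exact: s_obs_measurable.
by rewrite EFinB leeB.
Qed.

Lemma delta_le1 : delta <= 1.
Proof.
rewrite -lee_fin; apply: le_trans (delta_le 0) _.
by apply: probability_le1; exact: s_obs_measurable.
Qed.

Lemma first_time_infinite : P (N @^-1` [set None]) = 0%E.
Proof.
have mNone : measurable (N @^-1` [set None]).
  apply: measurable_stop_None => n; apply: stopping_measurable.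
  exact: stopping_first_time.
have PN : P (N @^-1` [set None]) \is a fin_num by exact: fin_num_measure.
apply/eqP; rewrite eq_le measure_ge0 andbT -(fineK PN) lee_fin.
apply: (@cvgr_to_ge _ \oo _ _ (fun n => (1 - delta) ^+ n)).
  apply: cvg_expr; rewrite ger0_norm ?subr_ge0 ?delta_le1//.
  by rewrite ltrBlDr ltrDl.
apply: nearW => n; rewrite -lee_fin fineK//.
apply: le_trans (alive_first_time_le n); apply: le_measure; rewrite ?inE//.
  by apply: alive_measurable; exact: stopping_first_time.
by move=> w /= Nw m _; rewrite Nw.
Qed.

(** The sum is the mean number of observations, compared with a geometric series. *)
Lemma alive_first_time_summable : (\sum_(0 <= n <oo) P (alive N n) <= (delta^-1)%:E)%E.
Proof.
apply: lime_le; first by apply: is_cvg_nneseries => n _ _.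
apply: nearW => n.
apply: (@le_trans _ _ (\sum_(0 <= k < n) ((1 - delta) ^+ k)%:E)%E).
  by apply: lee_sum => k _; exact: alive_first_time_le.
rewrite sumEFin lee_fin big_mkord -(@ler_pM2l _ delta)// mulfV ?gt_eqF//.
(* Delta times the partial sum telescopes to 1 - (1 - delta)^n. *)
have := subrX1 (1 - delta) n.
have : 0 <= (1 - delta) ^+ n by rewrite exprn_ge0// subr_ge0 delta_le1.
set S := \sum_(i < n) _; set x := _ ^+ n.
move=> x0; rewrite addrAC subrr add0r => e.
by rewrite -[delta * S]opprK -mulNr -e opprB gerBl.
Qed.

(** [X] at the stopping time is below the stopped sum, whose mean is at most B / delta by Wald:
    crude, but enough for finiteness. *)
Lemma at_time_first_time_lty X (B : R) : adapted X -> (forall n w, 0 <= X n w)%E ->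
  (forall n, \int[P]_w X n w <= B%:E)%E ->
  (\int[P]_w at_time 0 (X ^~ w) (N w) < +oo)%E.
Proof.
move=> aX X0 XB; have sN := stopping_first_time.
apply: le_lt_trans (le_at_time_total sN aX X0) _.
rewrite wald//.
apply: (@le_lt_trans _ _ (\sum_(0 <= n <oo) B%:E * P (alive N n))%E).
  apply: lee_nneseries => n _; first by rewrite mule_ge0// integral_ge0.
  by rewrite muleC lee_wpmul2r.
have B0 : 0 <= B by rewrite -lee_fin; apply: le_trans (XB 0); exact: integral_ge0.
rewrite nneseriesZl//.
apply: (@le_lt_trans _ _ (B%:E * (delta^-1)%:E)%E).
  by rewrite lee_wpmul2l ?lee_fin// alive_first_time_summable.
by rewrite -EFinM ltry.
Qed.

(** [V] vanishes before the first time of [E], so the stopped sum reduces to its last term; the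
    inequalities behind [search_bound] become equalities off the null event [None]. *)
Lemma search_first_time V k :
  adapted V -> (forall n w, 0 <= V n w)%E ->
  adapted k -> (forall n w, 0 <= k n w)%E ->
  (forall n, \int[P]_w V n w = \int[P]_w k n w)%E ->
  (forall n w, ~~ E n w -> V n w = 0)%E ->
  (\int[P]_w at_time 0 (V ^~ w) (N w) =
   \int[P]_w at_time +oo (fun n => \sum_(i < n.+1) k i w) (N w))%E.
Proof.
move=> aV V0 ak k0 Vk VE; have sN := stopping_first_time.
have ae_fin (Y1 Y2 : Omega -> \bar R) : (forall w n, N w = Some n -> Y1 w = Y2 w) ->
    ae_eq P setT Y1 Y2.
  move=> Y12; exists (N @^-1` [set None]); split.
  - by apply: measurable_stop_None => n; exact: stopping_measurable.
  - exact: first_time_infinite.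
  - move=> w /= nY; case Nw : (N w) => [n|]//; exfalso; apply: nY => _.
    exact: Y12 Nw.
transitivity (\int[P]_w total V N w)%E.
  apply: ge0_ae_eq_integral => //.
  - apply: measurable_at_time => n; first exact: adapted_measurable.
    exact: stopping_measurable.
  - exact: measurable_total.
  - by move=> w _; case: (N w) => //= n; exact: V0.
  - by move=> w _; exact: total_ge0.
  - apply: ae_fin => w n Nw; rewrite (total_at_time V0 Nw) Nw /=.
    rewrite big_ord_recr /= big1 ?add0e// => i _; apply: VE.
    by move/first_time_some : Nw => [_]; apply; exact: ltn_ord.
rewrite wald// (@eq_eseriesr _ _ (fun n => P (alive N n) * \int[P]_w k n w)%E); last first.
  by move=> n _; rewrite Vk.
rewrite -wald//; apply: ge0_ae_eq_integral => //.
- exact: measurable_total.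
- apply: (@measurable_at_time +oo%E (fun n w => \sum_(i < n.+1) k i w)%E) => n.
    by apply: emeasurable_sum => i; exact: adapted_measurable.
  exact: stopping_measurable.
- by move=> w _; exact: total_ge0.
- by move=> w _; case: (N w) => [n|]//=; exact: sume_ge0.
- by apply: ae_fin => w n Nw; rewrite (total_at_time k0 Nw) Nw.
Qed.

End first_time.
End stopped_sequences.

(** * Moments of the geometric and normal laws *)

Section moments.
Context {R : realType}.

Lemma geometric_nneseries (a q : R) : 0 <= q < 1 ->
  (\sum_(0 <= n <oo) (a * q ^+ n)%:E)%E = (a / (1 - q))%:E.
Proof.
move=> /andP[q0 q1]; apply: cvg_lim => //.
rewrite (_ : (fun n => _) = EFin \o series (sequences.geometric a q)).
  by apply: cvg_EFin; [exact: nearW|apply: cvg_geometric_series; rewrite ger0_norm].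
by apply/funext => n /=; rewrite -sumEFin.
Qed.

(** The mean is the sum over j of the tails P(X > j) = (1 - p)^j. *)
Lemma geometric_mean {d} {Omega : measurableType d} (P : probability Omega R)
    (p : R) (X : Omega -> nat) : 0 < p -> Defs.geometric P p X ->
  (\int[P]_w ((X w)%:R)%:E = (p^-1)%:E)%E.
Proof.
move=> p0 [mX PX].
have mXk (B : set nat) : measurable (X @^-1` B).
  by rewrite -[X in measurable X]setTI; exact: mX.
(* p is the probability of the value 1. *)
have p1 : p <= 1.
  by rewrite -lee_fin -[p]mulr1 -(expr0 (1 - p)) -(PX 1%N)//; exact: probability_le1.
have q01 : 0 <= 1 - p < 1 by rewrite subr_ge0 p1 ltrBlDr ltrDl.
have pE : 1 - (1 - p) = p by ring.
have tail j : P [set w | (j < X w)%N] = ((1 - p) ^+ j)%:E.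
  have -> : [set w | (j < X w)%N] = \bigcup_i (X @^-1` [set (j + i).+1]).
    apply/seteqP; split => [w /= jX|w [i _ /= ->]]; last by rewrite ltnS leq_addr.
    by exists (X w - j.+1)%N => //=; rewrite -addSn subnKC.
  rewrite measure_bigcup//; last first.
    by apply/trivIsetP => i1 i2 _ _ i12; apply/seteqP; split => w //= [-> [] /addnI]; exact/eqP.
  rewrite (@eq_eseriesl _ _ xpredT); last by move=> i; rewrite in_setT.
  rewrite (@eq_eseriesr _ _ (fun i => (p * (1 - p) ^+ j * (1 - p) ^+ i)%:E)); last first.
    by move=> i _; rewrite -mulrA -exprD; exact: PX.
  by rewrite geometric_nneseries// pE mulrAC divff ?mul1r// gt_eqF.
transitivity (\int[P]_w \sum_(0 <= j <oo) (\1_[set w | (j < X w)%N] w)%:E)%E.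
  apply: eq_integral => w _; rewrite (nneseries_split 0 (X w)); last first.
    by move=> j _; rewrite lee_fin.
  rewrite eseries0 ?adde0; last first.
    move=> j; rewrite add0n => Xj _; rewrite indicE memNset//= ltnNge Xj//.
  rewrite add0n (eq_big_nat _ _ (F2 := fun=> 1%E)); last first.
    by move=> j /= jX; rewrite indicE mem_set.
  rewrite sumEFin big_const_nat subn0; congr EFin.
  by elim: (X w) => //= n <-; rewrite -natr1 addrC.
rewrite integral_nneseries//; last first.
  move=> j; apply/measurable_EFinP; apply: measurable_indic.
  exact: (mXk [set i | (j < i)%N]).
rewrite (@eq_eseriesr _ _ (fun j => (1 * (1 - p) ^+ j)%:E)).
  by rewrite geometric_nneseries// pE div1r.
move=> j _; rewrite integral_indic//; last exact: (mXk [set i | (j < i)%N]).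
by rewrite mul1r -tail; congr (P _); exact: setIT.
Qed.

(** The Radon-Nikodym derivative and [normal_pdf] have the same integral over every measurable set,
    so they agree almost everywhere. *)
Lemma ge0_integral_normal_prob (m s : R) (f : R -> \bar R) :
  measurable_fun setT f -> (forall x, 0 <= f x)%E ->
  (\int[normal_prob m s]_x f x =
   \int[lebesgue_measure]_x (f x * (normal_pdf m s x)%:E))%E.
Proof.
move=> mf f0.
rewrite -(Radon_Nikodym_SigmaFinite.change_of_variables
  (normal_prob_dominates m s) f0 measurableT mf).
have mp : measurable_fun setT (fun x => (normal_pdf m s x)%:E).
  by apply/measurable_EFinP; exact: measurable_normal_pdf.
have RNi := Radon_Nikodym_SigmaFinite.f_integrable (normal_prob_dominates m s).
apply: ae_eq_integral => //.
- by apply: emeasurable_funM => //; exact: measurable_int RNi.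
- exact: emeasurable_funM.
- apply: ae_eqe_mul2l; apply: integral_ae_eq => // E _ mE.
  by rewrite -Radon_Nikodym_SigmaFinite.f_integral//; exact: normal_prob_dominates.
Qed.

(** With u = x^2 / (4 s^2), the Gaussian factor for deviation s is e^-u e^-u and the one for s sqrt
    2 is e^-u. Since u e^-u <= 1, x^2 times the first density is at most a multiple of the second,
    whose integral is 1. *)
Lemma normal_second_moment (s : R) : s != 0 ->
  (\int[normal_prob 0 s]_x (x ^+ 2)%:E < +oo)%E.
Proof.
move=> s0; set s2 := s * Num.sqrt 2.
have s20 : s2 != 0 by rewrite mulf_neq0// gt_eqF// sqrtr_gt0.
have s22 : s2 ^+ 2 = s ^+ 2 * 2 by rewrite exprMn sqr_sqrtr.
have ss : 0 < s ^+ 2 by rewrite exprn_even_gt0.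
have mx2 : measurable_fun setT (fun x : R => (x ^+ 2)%:E).
  by apply/measurable_EFinP; exact: measurable_funX.
rewrite ge0_integral_normal_prob//; last by move=> x; rewrite lee_fin sqr_ge0.
(* The factor 4 s^2 comes from x^2 = 4 s^2 u; the quotient of peaks adjusts the normalizations. *)
pose c := s ^+ 2 * 4 * normal_peak s / normal_peak s2.
have c0 : 0 <= c.
  apply: mulr_ge0; rewrite ?invr_ge0 ?normal_peak_ge0//.
  by apply: mulr_ge0; rewrite ?normal_peak_ge0//; apply: mulr_ge0 => //; exact: ltW.
have bound (x : R) : x ^+ 2 * normal_pdf 0 s x <= c * normal_pdf 0 s2 x.
  rewrite !normal_pdfE//; set u := x ^+ 2 / (s ^+ 2 * 4).
  have e1 : normal_fun 0 s x = expR (- u) * expR (- u).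
    by rewrite /normal_fun -expRD subr0 /u; congr expR; field.
  have e2 : normal_fun 0 s2 x = expR (- u).
    by rewrite /normal_fun subr0 s22 /u; congr expR; field.
  have x2 : x ^+ 2 = s ^+ 2 * 4 * u by rewrite /u; field.
  rewrite e1 e2 x2 /c.
  rewrite (_ : _ / _ * (_ * _) = s ^+ 2 * 4 * normal_peak s * expR (- u)); last first.
    by field; rewrite gt_eqF// normal_peak_gt0.
  rewrite (_ : _ * _ * _ = (s ^+ 2 * 4 * normal_peak s * expR (- u)) * (u * expR (- u))).
    rewrite ler_piMr//.
      apply: mulr_ge0; rewrite ?expR_ge0//; apply: mulr_ge0; rewrite ?normal_peak_ge0//.
      by apply: mulr_ge0 => //; exact: ltW.
    rewrite expRN -ler_pdivlMr ?invr_gt0 ?expR_gt0// invrK mul1r.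
    by apply: le_trans (expR_ge1Dx u); rewrite lerDr.
  by ring.
apply: (@le_lt_trans _ _
    (\int[lebesgue_measure]_x (c%:E * (normal_pdf 0 s2 x)%:E))%E); last first.
  rewrite integralZl//; last exact: integrable_normal_pdf.
  by rewrite integral_normal_pdf mule1 ltry.
apply: ge0_le_integral => //.
- by move=> x _; rewrite -EFinM lee_fin mulr_ge0 ?sqr_ge0 ?normal_pdf_ge0.
- apply: emeasurable_funM => //.
  by apply/measurable_EFinP; exact: measurable_normal_pdf.
- apply: emeasurable_funM => //.
  by apply/measurable_EFinP; exact: measurable_normal_pdf.
- by move=> x _; rewrite -!EFinM lee_fin; exact: bound.
Qed.

(** [M] depends on [v] alone, so that one bound serves all gains at all times. *)
Lemma complex_gaussian_second_moment {d} {Omega : measurableType d}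
    (P : probability Omega R) (v : R) : 0 < v ->
  exists2 M : R, 0 <= M & forall Z, complex_gaussian P v Z ->
  (\int[P]_w ((ComplexField.Normc.normc (Z w)) ^+ 2)%:E = M%:E)%E.
Proof.
move=> v0; set s := Num.sqrt (v / 2).
have s0 : s != 0 by rewrite gt_eqF// sqrtr_gt0 divr_gt0.
have mx2 : measurable_fun setT (fun x : R => (x ^+ 2)%:E).
  by apply/measurable_EFinP; exact: measurable_funX.
have x20 (x : R) : (0 <= (x ^+ 2)%:E)%E by rewrite lee_fin sqr_ge0.
set m2 := (\int[normal_prob 0 s]_x (x ^+ 2)%:E)%E.
have m2fin : m2 \is a fin_num.
  by rewrite ge0_fin_numE ?normal_second_moment//; exact: integral_ge0.
exists (fine m2 + fine m2).
  by rewrite addr_ge0// fine_ge0//; exact: integral_ge0.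
move=> Z [mZ PZ]; rewrite EFinD fineK//.
have mRe : measurable_fun setT (fun w => complex.Re (Z w)).
  exact: (measurableT_comp measurable_fst mZ).
have mIm : measurable_fun setT (fun w => complex.Im (Z w)).
  exact: (measurableT_comp measurable_snd mZ).
have law (X : Omega -> R) (mX : measurable_fun setT X) :
    (forall U, measurable U -> P (X @^-1` U) = normal_prob 0 s U) ->
    (\int[P]_w ((X w) ^+ 2)%:E = m2)%E.
  move=> PX; pose X' : Omega -> measurableTypeR R := X.
  have mX' : measurable_fun setT X' by exact: mX.
  transitivity (\int[pushforward P X']_x (x ^+ 2)%:E)%E.
    by rewrite ge0_integral_pushforward.
  by apply: eq_measure_integral => U mU _; exact: PX.
transitivity (\int[P]_w (((complex.Re (Z w)) ^+ 2)%:E + ((complex.Im (Z w)) ^+ 2)%:E))%E.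
  apply: eq_integral => w _; case: (Z w) => a b /=.
  by rewrite sqr_sqrtr ?addr_ge0 ?sqr_ge0.
rewrite ge0_integralD//; last 2 first.
- by apply/measurable_EFinP; exact: measurable_funX.
- by apply/measurable_EFinP; exact: measurable_funX.
have prodE (A B : set R) : measurable A -> measurable B ->
    (normal_prob 0 s \x normal_prob 0 s)%E (A `*` B) =
    (normal_prob 0 s A * normal_prob 0 s B)%E.
  by move=> mA mB; exact: product_measure1E.
have nT : normal_prob 0 s setT = 1%E := probability_setT (normal_prob 0 s).
congr (_ + _)%E; apply: law => // U mU.
- have := PZ (U `*` setT) (measurableX mU measurableT).
  rewrite prodE// nT mule1 => <-.
  by congr (P _); apply/seteqP; split => w //= [].
- have := PZ (setT `*` U) (measurableX measurableT mU).
  rewrite prodE// nT mul1e => <-.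
  by congr (P _); apply/seteqP; split => w //= [].
Qed.

End moments.

(** * Contention layers *)

Section layers.
Context {R : realType} {d : measure_display} {Omega : measurableType d}.
Variables (P : probability Omega R) (u : nat) (I : finType) (p v : R).
Variables (s : nat -> Omega -> 'I_u) (k : nat -> Omega -> nat)
  (h : nat -> I -> Omega -> R[i]).
Hypothesis layer : contention_layer P p v s k h.

Lemma discrete_events_setI {A : Type} (X : Omega -> A) :
  setI_closed (discrete_events X).
Proof.
move=> _ _ [B1 _ <-] [B2 _ <-]; exists (B1 `&` B2) => //.
by rewrite !setTI preimage_setI.
Qed.

Lemma complex_events_setI (Z : Omega -> R[i]) : setI_closed (complex_events Z).
Proof.
move=> _ _ [B1 m1 <-] [B2 m2 <-]; exists (B1 `&` B2); first exact: measurableI.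
by rewrite !setTI preimage_setI.
Qed.

Let events (x : nat + nat + nat * I) : set_system Omega :=
  match x with
  | inl (inl n) => discrete_events (s n)
  | inl (inr n) => discrete_events (k n)
  | inr (n, i) => complex_events (h n i)
  end.

Let time (x : nat + nat + nat * I) : nat :=
  match x with inl (inl n) => n | inl (inr n) => n | inr (n, _) => n end.

Lemma layer_events_measurable x : events x `<=` measurable.
Proof.
move: x => [[n|n]|[n i]] _ [B mB <-]; rewrite setTI.
- have -> : s n @^-1` B = \bigcup_(j in [set j | B j]) (s n @^-1` [set j]).
    apply/seteqP; split => [w Bw|w [j /= Bj sj]]; first by exists (s n w).
    by rewrite /preimage /= sj.
  apply: fin_bigcup_measurable => // j _.
  by have [] := layer_uniform layer n j.
- have [mk _] := layer_geometric layer n.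
  by rewrite -[X in measurable X]setTI; exact: mk.
- have [mh _] := layer_gaussian layer n i.
  by rewrite -[X in measurable X]setTI; exact: mh.
Qed.

Lemma layer_group_independent (J1 J2 : set (nat + nat + nat * I)) (A B : set Omega) :
  J1 `&` J2 = set0 ->
  <<s \bigcup_(x in J1) events x >> A -> <<s \bigcup_(x in J2) events x >> B ->
  independent_events P A B.
Proof.
move=> J12; apply: mutually_independent_group J12 _ _.
- by move=> [[n|n]|[n i]]; [exact: discrete_events_setI..|exact: complex_events_setI].
- by move=> [[n|n]|[n i]]; exists setT; rewrite ?setTI.
- exact: layer_events_measurable.
- by have := layer_independent layer.
Qed.

Lemma layer_choice_independent n i (A B : set Omega) :
  discrete_events (s n) A -> complex_events (h n i) B -> independent_events P A B.
Proof.
move=> sA hB.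
apply: (@layer_group_independent [set inl (inl n)] [set inr (n, i)]).
- by apply/seteqP; split => x //= [->].
- by apply: sub_sigma_algebra; exists (inl (inl n)).
- by apply: sub_sigma_algebra; exists (inr (n, i)).
Qed.

Variables (J : Type) (c : J -> 'I_u -> I).

(* c j i is the index of the j-th gain observed when i wins: c j i = (i, j) in the
   main layer, c tt i = i in the sub-layer. *)
Definition winner (n : nat) (j : J) (w : Omega) : R[i] := h n (c j (s n w)) w.

(** Shaped so that [past observation \o succn] unfolds to the filtration of either layer. *)
Definition observation (n : nat) : set_system Omega :=
  discrete_events (s n) `|` discrete_events (k n) `|`
    \bigcup_j complex_events (winner n j).

(** Where i wins, the winner's gain is the gain of index [c j i]; its events are thus finite unions
    over i of events of the block at time n. *)
Lemma observation_events n :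
  <<s observation n >> `<=` <<s \bigcup_(x in [set x | time x = n]) events x >>.
Proof.
apply: smallest_sub; first exact: smallest_sigma_algebra.
move=> A [[sA|kA]|[j _ [B mB <-]]].
- by apply: sub_sigma_algebra; exists (inl (inl n)).
- by apply: sub_sigma_algebra; exists (inl (inr n)).
- have -> : setT `&` (re_im \o winner n j) @^-1` B =
      \bigcup_(i in [set: 'I_u])
        ((s n @^-1` [set i]) `&` ((re_im \o h n (c j i)) @^-1` B)).
    rewrite setTI; apply/seteqP; split => [w Bw|w [i _ [/= <-]//]].
    by exists (s n w).
  apply: (@fin_bigcup_measurable _ (g_sigma_algebraType _)) => // i _.
  apply: (@measurableI _ (g_sigma_algebraType _)); apply: sub_sigma_algebra.
    by exists (inl (inl n)) => //; exists [set i]; rewrite ?setTI.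
  by exists (inr (n, c j i)) => //; exists B; rewrite ?setTI.
Qed.

Lemma observation_measurable n : observation n `<=` measurable.
Proof.
have obsm : <<s observation n >> `<=` measurable; last first.
  by move=> A oA; apply: obsm; exact: sub_sigma_algebra.
apply: subset_trans (@observation_events n) _.
apply: smallest_sub; first exact: sigma_algebra_measurable.
by move=> A [x _]; exact: layer_events_measurable.
Qed.

(** Past and present live on disjoint blocks: the times below n and the time n. *)
Lemma observation_independent n A B :
  past observation n A -> <<s observation n >> B -> independent_events P A B.
Proof.
move=> pA oB.
apply: (@layer_group_independent [set x | (time x < n)%N] [set x | time x = n]).
- by apply/seteqP; split => x //= [] /[swap] ->; rewrite ltnn.
- move: A pA; apply: smallest_sub; first exact: smallest_sigma_algebra.
  move=> A [m /= mn oA].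
  have /observation_events : <<s observation m >> A by exact: sub_sigma_algebra.
  by apply: sub_sigma_algebra2; apply: bigcup_subset => x /= ->.
- exact: observation_events.
Qed.

Lemma measurable_winner n j :
  measurable_fun (T := g_sigma_algebraType (observation n)) setT
    (re_im \o winner n j).
Proof.
move=> _ B mB; apply: sub_sigma_algebra; right; exists j => //.
by exists B.
Qed.

Lemma measurable_choice n (A : set 'I_u) : <<s observation n >> (s n @^-1` A).
Proof.
by apply: sub_sigma_algebra; left; left; exists A; rewrite ?setTI.
Qed.

Lemma measurable_count n :
  measurable_fun (T := g_sigma_algebraType (observation n)) setT (k n).
Proof.
by move=> _ B mB; apply: sub_sigma_algebra; left; right; exists B.
Qed.

Definition slot_cost (a : R) (n : nat) (w : Omega) : \bar R := (a * (k n w)%:R)%:E.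

Lemma adapted_slot_cost a : adapted observation (slot_cost a).
Proof.
move=> n; apply/measurable_EFinP.
apply: measurable_funM => //.
by move=> _ U mU; exact: (@measurable_count n measurableT [set m | U m%:R]).
Qed.

Lemma mean_slot_cost a n : 0 < p -> 0 <= a ->
  (\int[P]_w slot_cost a n w = (a / p)%:E)%E.
Proof.
move=> p0 a0; rewrite /slot_cost.
under eq_integral do rewrite EFinM.
have mk : measurable_fun setT (fun w => ((k n w)%:R : R)%:E).
  have [mk _] := layer_geometric layer n.
  apply/measurable_EFinP.
  by move=> _ U mU; exact: (mk measurableT [set m | U m%:R]).
rewrite ge0_integralZl//.
by rewrite (geometric_mean p0 (layer_geometric layer n)) EFinM.
Qed.

End layers.

(** * Measurability and size of the rate *)

Section rates.
Context {R : realType}.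
Local Notation normc := ComplexField.Normc.normc.

Lemma normc_sqr (z : R[i]) :
  normc z = Num.sqrt ((re_im z).1 ^+ 2 + (re_im z).2 ^+ 2).
Proof. by case: z. Qed.

Lemma normc_nonneg (z : R[i]) : 0 <= normc z.
Proof. by rewrite normc_sqr sqrtr_ge0. Qed.

Lemma measurable_normc {d} {T : measurableType d} (Z : T -> R[i]) :
  measurable_fun setT (re_im \o Z) -> measurable_fun setT (fun t => normc (Z t)).
Proof.
move=> mZ.
have -> : (fun t => normc (Z t)) =
    Num.sqrt \o (fun t => (re_im (Z t)).1 ^+ 2 + (re_im (Z t)).2 ^+ 2).
  by apply/funext => t; rewrite normc_sqr.
apply: measurableT_comp.
  by apply: continuous_measurable_fun => x; exact: sqrt_continuous.
apply: measurable_funD; apply: measurable_funX.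
  exact: (measurableT_comp measurable_fst mZ).
exact: (measurableT_comp measurable_snd mZ).
Qed.

Variables (Ps Pr : R).
Hypotheses (Ps_gt0 : 0 < Ps) (Pr_gt0 : 0 < Pr).

(** 1 + ab / (1 + a + b) = (1 + a)(1 + b) / (1 + a + b). Both measurability and [rate_le] come from
    this form. *)
Lemma rateE (z w : R[i]) :
  rate Ps Pr z w =
  (ln (1 + Ps * normc z ^+ 2) + ln (1 + Pr * normc w ^+ 2) -
   ln (1 + Ps * normc z ^+ 2 + Pr * normc w ^+ 2)) / ln 2.
Proof.
rewrite /rate /log2; congr (_ / _).
set a := Ps * _ ^+ 2; set b := Pr * _ ^+ 2.
have a0 : 0 <= a by rewrite mulr_ge0 ?sqr_ge0 ?ltW.
have b0 : 0 <= b by rewrite mulr_ge0 ?sqr_ge0 ?ltW.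
have a1 : 0 < 1 + a by rewrite ltr_pwDl.
have b1 : 0 < 1 + b by rewrite ltr_pwDl.
have ab1 : 0 < 1 + a + b by rewrite ltr_pwDl.
rewrite -lnM// -ln_div ?posrE ?mulr_gt0//; congr ln.
rewrite (_ : Ps * Pr * _ * _ = a * b); last by rewrite /a /b; ring.
by field; rewrite gt_eqF.
Qed.

Lemma ln2_pos : 0 < ln (2 : R). Proof. by rewrite ln_gt0// ltr1n. Qed.

Lemma measurable_rate {d} {T : measurableType d} (Z W : T -> R[i]) :
  measurable_fun setT (fun t => normc (Z t)) ->
  measurable_fun setT (fun t => normc (W t)) ->
  measurable_fun setT (fun t => rate Ps Pr (Z t) (W t)).
Proof.
move=> mZ mW; under eq_fun do rewrite rateE.
have mln (f : T -> R) : measurable_fun setT f -> measurable_fun setT (fun t => ln (f t)).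
  by move=> mf; exact: (measurableT_comp (@measurable_ln R) mf).
have mP (c : R) (f : T -> R) : measurable_fun setT f ->
    measurable_fun setT (fun t => c * f t ^+ 2).
  by move=> mf; apply: measurable_funM => //; exact: measurable_funX.
have mPZ := mP Ps _ mZ; have mPW := mP Pr _ mW.
apply: measurable_funM => //; apply: measurable_funB.
  by apply: measurable_funD; apply: mln; apply: measurable_funD.
by apply: mln; apply: measurable_funD => //; apply: measurable_funD.
Qed.

Lemma rate_ge0 (z w : R[i]) : 0 <= rate Ps Pr z w.
Proof.
have a0 : 0 <= Ps * normc z ^+ 2 by rewrite mulr_ge0 ?sqr_ge0// ltW.
have b0 : 0 <= Pr * normc w ^+ 2 by rewrite mulr_ge0 ?sqr_ge0// ltW.
rewrite /rate /log2; apply: divr_ge0; last exact: ltW ln2_pos.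
apply: ln_ge0; rewrite lerDl; apply: divr_ge0; last by rewrite !addr_ge0.
rewrite (_ : _ * _ = (Ps * normc z ^+ 2) * (Pr * normc w ^+ 2)); first exact: mulr_ge0.
by ring.
Qed.

(** Dropping ln(1 + b) - ln(1 + a + b) <= 0 leaves ln(1 + x^2) with x = sqrt Ps |z|, and ln(1 + x^2)
    <= 2 ln(1 + x) <= 2x. The bound is free of w: for fixed gains z the sub-layer rewards are
    bounded. *)
Lemma rate_le (z w : R[i]) : rate Ps Pr z w <= 2 * Num.sqrt Ps / ln 2 * normc z.
Proof.
have lnD (x : R) : 0 <= x -> ln (1 + x ^+ 2) <= 2 * x.
  move=> x0; apply: (@le_trans _ _ (ln ((1 + x) ^+ 2))).
    rewrite ler_ln ?posrE ?ltr_pwDl ?sqr_ge0// ?exprn_gt0 ?ltr_pwDl//.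
    by nra.
  rewrite lnXn ?ltr_pwDl// mulr_natl lerMn2r/= le_ln1Dx//.
  exact: lt_le_trans x0.
rewrite rateE mulrAC ler_pM2r ?invr_gt0 ?ln2_pos//.
have sPs : Ps = Num.sqrt Ps ^+ 2 by rewrite sqr_sqrtr// ltW.
apply: (@le_trans _ _ (ln (1 + Ps * normc z ^+ 2))).
  rewrite -addrA gerDl subr_le0 ler_ln ?posrE.
  - by rewrite lerD2r lerDl mulr_ge0 ?sqr_ge0// ltW.
  - by rewrite ltr_pwDl// mulr_ge0 ?sqr_ge0// ltW.
  - by rewrite ltr_pwDl ?ltr_pwDl// mulr_ge0 ?sqr_ge0// ltW.
rewrite [in leLHS]sPs -exprMn; apply: le_trans (lnD _ _) _.
  by rewrite mulr_ge0 ?normc_nonneg.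
by rewrite mulrA.
Qed.

End rates.

(** * Expectations of functions of the winner and its gain *)

Section layer_expectations.
Context {R : realType} {d : measure_display} {Omega : measurableType d}.
Variables (P : probability Omega R) (u : nat) (I : finType) (p v : R).
Variables (s : nat -> Omega -> 'I_u) (k : nat -> Omega -> nat)
  (h : nat -> I -> Omega -> R[i]).
Hypothesis layer : contention_layer P p v s k h.

Lemma integral_probability_cst (r : R) : (\int[P]_w r%:E = r%:E)%E.
Proof.
rewrite integral_cst// -[RHS]mule1; congr (_ * _)%E; exact: probability_setT.
Qed.

Lemma eq_law_integral (Z1 Z2 : Omega -> R[i]) (F : R * R -> \bar R) :
  complex_gaussian P v Z1 -> complex_gaussian P v Z2 ->
  measurable_fun setT F -> (forall b, 0 <= F b)%E ->
  (\int[P]_w F (re_im (Z1 w)) = \int[P]_w F (re_im (Z2 w)))%E.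
Proof.
move=> [m1 law1] [m2 law2] mF F0.
transitivity (\int[pushforward P (re_im \o Z1)]_b F b)%E.
  by rewrite ge0_integral_pushforward.
transitivity (\int[pushforward P (re_im \o Z2)]_b F b)%E; last first.
  by rewrite ge0_integral_pushforward.
apply: (@eq_measure_integral _ _ _ setT
  (measure_function_pushforward__canonical__measure_function_Measure P m2)
  (measure_function_pushforward__canonical__measure_function_Measure P m1)).
by move=> U mU _; rewrite /= /pushforward law1// law2.
Qed.

(** Split according to the winner: [s n] is independent of each gain at time n, and neither the
    uniform nor the Gaussian law depends on n. *)
Lemma winner_integral (c : 'I_u -> I) (n m : nat) (F : 'I_u -> R * R -> \bar R) :
  (forall i, measurable_fun setT (F i)) -> (forall i b, 0 <= F i b)%E ->
  (\int[P]_w F (s n w) (re_im (h n (c (s n w)) w)) =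
   \int[P]_w F (s m w) (re_im (h m (c (s m w)) w)))%E.
Proof.
move=> mF F0.
have split l : (\int[P]_w F (s l w) (re_im (h l (c (s l w)) w)) =
    \sum_(i < u) (u%:R^-1)%:E * \int[P]_w F i (re_im (h 0%N (c i) w)))%E.
  have msi i : measurable (s l @^-1` [set i]) by have [] := layer_uniform layer l i.
  have mh i : measurable_fun setT (fun w => F i (re_im (h l (c i) w))).
    by have [mh _] := layer_gaussian layer l (c i); exact: (measurableT_comp (mF i) mh).
  transitivity (\int[P]_w
      \sum_(i < u) ((fun w => F i (re_im (h l (c i) w))) \_ (s l @^-1` [set i])) w)%E.
    apply: eq_integral => w _; rewrite (bigD1 (s l w))//= patchE mem_set//.
    rewrite big1 ?adde0// => i si; rewrite patchE memNset//= => e.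
    by rewrite e eqxx in si.
  rewrite ge0_integral_sum//; last 2 first.
  - move=> i; apply/(measurable_restrictT _ (msi i)).
    exact: measurable_funTS.
  - by move=> i w _; apply: erestrict_ge0.
  apply: eq_bigr => i _; rewrite -integral_mkcond.
  rewrite (independent_integral (msi i) (mh i))//.
    have [_ ->] := layer_uniform layer l i; congr (_ * _)%E.
    by apply: eq_law_integral => //; exact: (layer_gaussian layer).
  move=> U mU; apply: (layer_choice_independent layer (n := l) (i := c i)).
    by exists [set i]; rewrite ?setTI.
  exists (F i @^-1` U); last by rewrite setTI.
  by rewrite -[X in measurable X]setTI; exact: mF.
by rewrite !split.
Qed.

End layer_expectations.

(** An integrable function is finite almost everywhere, and this one is [+oo] on [None]. *)
Lemma at_time_lty_none {R : realType} {d : measure_display}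
    {Omega : measurableType d} (P : probability Omega R)
    (Y : nat -> Omega -> \bar R) (N : Omega -> option nat) :
  (forall n, measurable_fun setT (Y n)) -> (forall n w, 0 <= Y n w)%E ->
  (forall n, measurable (N @^-1` [set Some n])) ->
  (\int[P]_w at_time +oo (Y ^~ w) (N w) < +oo)%E -> P (N @^-1` [set None]) = 0%E.
Proof.
move=> mY Y0 mN Nfin; apply: measure_negligible; first exact: measurable_stop_None.
have iY : P.-integrable setT (fun w => at_time +oo (Y ^~ w) (N w)).
  apply/integrableP; split; first exact: measurable_at_time.
  rewrite (eq_integral (fun w => at_time +oo (Y ^~ w) (N w)))// => w _.
  by rewrite gee0_abs//; case: (N w) => [n|] //=.
have [A [mA A0 NA]] := integrable_ae measurableT iY.
exists A; split => // w /= Nw; apply: NA => /=.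
by rewrite Nw => /(_ Logic.I).
Qed.

Section costs.
Context {R : realType} {Omega : Type}.

Lemma elapsed_cost (T tau gamma : R) (k : nat -> Omega -> nat) n w :
  ((gamma * elapsed T tau k n w)%:E =
   (T / 2 * gamma)%:E + \sum_(i < n.+1) (gamma * tau / 2 * (k i w)%:R)%:E)%E.
Proof.
rewrite sumEFin -EFinD; congr EFin; rewrite /elapsed mulrDr -mulr_sumr.
by ring.
Qed.

End costs.

(** * The sub-layer problem *)

Section sublayer.
Context {R : realType} {d : measure_display} {Omega : measurableType d}.
Variables (T tau Ps Pr : R) (L : nat) (Q : probability Omega R) (p v : R).
Variables (s : nat -> Omega -> 'I_L) (k : nat -> Omega -> nat)
  (g : nat -> 'I_L -> Omega -> R[i]) (gamma : R).
Hypotheses (T_gt0 : 0 < T) (tau_gt0 : 0 < tau) (Ps_gt0 : 0 < Ps)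
  (Pr_gt0 : 0 < Pr) (p_gt0 : 0 < p) (gamma_gt0 : 0 < gamma).
Hypothesis layer : contention_layer Q p v s k g.
Local Notation normc := ComplexField.Normc.normc.
Implicit Types z : 'I_L -> R[i].

Let obs := observation s k g (fun (_ : unit) i => i).
Let obsm := observation_measurable layer (c := fun (_ : unit) i => i).
Let obsi := observation_independent layer (c := fun (_ : unit) i => i).

(* c0 prices the transmission time T/2, a the contention slots of one observation. *)
Let c0 := T / 2 * gamma.
Let a := gamma * tau / 2 / p.

Let a_gt0 : 0 < a. Proof. by rewrite !divr_gt0// mulr_gt0. Qed.
Let c0_gt0 : 0 < c0. Proof. by rewrite mulr_gt0// divr_gt0. Qed.

(** Summing over all j removes the dependence on the random winner. *)
Definition reward_bound z : R :=
  T / 2 * (2 * Num.sqrt Ps / ln 2) * \sum_(j < L) normc (z j).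

Local Notation X := (sub_reward T Ps Pr s g).

Lemma sub_reward_ge0 z m w : 0 <= X z m w.
Proof. by rewrite mulr_ge0 ?rate_ge0// ltW// divr_gt0. Qed.

Lemma reward_bound_ge0 z : 0 <= reward_bound z.
Proof.
rewrite mulr_ge0 ?sumr_ge0// => [|i _]; last exact: normc_nonneg.
rewrite mulr_ge0//; first by rewrite ltW// divr_gt0.
by rewrite divr_ge0 ?mulr_ge0 ?sqrtr_ge0// ltW// ln2_pos.
Qed.

Lemma sub_reward_le z m w : X z m w <= reward_bound z.
Proof.
rewrite /sub_reward /reward_bound -(mulrA (T / 2)) ler_pM2l ?divr_gt0//.
apply: le_trans (rate_le Ps_gt0 Pr_gt0 _ _) _; rewrite ler_wpM2l//.
  by rewrite divr_ge0 ?mulr_ge0 ?sqrtr_ge0// ltW// ln2_pos.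
by rewrite (bigD1 (s m w))//= lerDl sumr_ge0// => i _; exact: normc_nonneg.
Qed.

(** The parameter t is trivial when adaptedness is wanted, and is the main-layer outcome when
    Fubini-Tonelli is applied. *)
Lemma measurable_sub_reward {d1} {T1 : measurableType d1} (z : T1 -> 'I_L -> R[i]) m :
  (forall j, measurable_fun setT (fun t => normc (z t j))) ->
  measurable_fun setT
    (fun x : T1 * g_sigma_algebraType (obs m) => X (z x.1) m x.2).
Proof.
move=> mz; apply: measurable_funM => //; apply: measurable_rate => //; last first.
  apply: (measurableT_comp (f := fun w : g_sigma_algebraType (obs m) =>
    normc (winner s g (fun (_ : unit) i => i) m tt w)) _ measurable_snd).
  by apply: measurable_normc; exact: measurable_winner.
(* The sum over possible winners separates the parameter from the outcome. *)
have -> : (fun t : T1 * g_sigma_algebraType (obs m) => normc (z t.1 (s m t.2))) =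
    (fun t => \sum_(j < L) normc (z t.1 j) * \1_(s m @^-1` [set j]) t.2).
  apply/funext => -[t w] /=; rewrite (bigD1 (s m w))//= indicE mem_set// mulr1.
  rewrite big1 ?addr0// => i si; rewrite indicE memNset ?mulr0//= => e.
  by rewrite e eqxx in si.
apply: measurable_sum => j; apply: measurable_funM.
  exact: (measurableT_comp (mz j) measurable_fst).
apply: (measurableT_comp _ measurable_snd).
by apply: measurable_indic; exact: measurable_choice.
Qed.

Lemma adapted_sub_reward z : adapted obs (fun m w => (X z m w)%:E).
Proof.
move=> m; apply/measurable_EFinP.
have := @measurable_sub_reward _ unit (fun _ => z) m (fun j => measurable_cst _).
move=> /measurableT_comp /(_ (measurable_pair1 tt)); exact.
Qed.

(* The reservation value is parametrized by r = w + c0, where w is the root of the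
   sub-layer equation; w may be negative, r may be as well. *)
Definition excess z (r : R) m w : R := Num.max (X z m w - r) 0.

Lemma excess_ge0 z r m w : 0 <= excess z r m w.
Proof. by rewrite le_max lexx orbT. Qed.

Lemma adapted_excess z r : adapted obs (fun m w => (excess z r m w)%:E).
Proof.
move=> m; apply/measurable_EFinP; apply: measurable_maxr => //.
by apply: measurable_funB => //; have /measurable_EFinP := adapted_sub_reward z (n := m).
Qed.

Definition mean_excess z r : \bar R := (\int[Q]_w (excess z r 0 w)%:E)%E.

Lemma mean_excessE z r m : (\int[Q]_w (excess z r m w)%:E)%E = mean_excess z r.
Proof.
pose F (i : 'I_L) (b : R * R) : \bar R :=
  (Num.max (T / 2 * rate Ps Pr (z i) (complex.Complex b.1 b.2) - r) 0)%:E.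
have FE n w : (excess z r n w)%:E = F (s n w) (re_im (g n (s n w) w)).
  by rewrite /F /excess /sub_reward /sub_rate /=; case: (g n (s n w) w).
rewrite /mean_excess; under eq_integral do rewrite FE.
under [RHS]eq_integral do rewrite FE.
apply: (winner_integral layer (fun i => i)) => [i|i b]; last first.
  by rewrite lee_fin le_max lexx orbT.
apply/measurable_EFinP; apply: measurable_maxr => //; apply: measurable_funB => //.
apply: measurable_funM => //; apply: measurable_rate => //.
apply: measurable_normc.
by rewrite (_ : _ \o _ = id)//; apply/funext => -[].
Qed.

Lemma mean_excess_fin z r : mean_excess z r \is a fin_num.
Proof.
rewrite ge0_fin_numE; last by apply: integral_ge0 => w _; rewrite lee_fin excess_ge0.
apply: (@le_lt_trans _ _ (\int[Q]_w (reward_bound z + `|r|)%:E)%E).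
  apply: ge0_le_integral => //.
  - by move=> w _; rewrite lee_fin excess_ge0.
  - exact: (adapted_measurable obsm 0%N (adapted_excess z r)).
  - move=> w _; rewrite lee_fin ge_max addr_ge0 ?reward_bound_ge0// andbT.
    by rewrite lerD ?sub_reward_le// -normrN ler_norm.
by rewrite integral_probability_cst ltry.
Qed.

Lemma mean_excess_lipschitz z r r' :
  (mean_excess z r <= mean_excess z r' + (`|r - r'|)%:E)%E.
Proof.
have mE x := adapted_measurable obsm 0%N (adapted_excess z x).
have E0 x w : setT w -> (0 <= (excess z x 0 w)%:E)%E.
  by move=> _; rewrite lee_fin excess_ge0.
have -> : (mean_excess z r' + (`|r - r'|)%:E =
    \int[Q]_w ((excess z r' 0 w)%:E + (`|r - r'|)%:E))%E.
  rewrite (ge0_integralD _ _ (E0 r') (mE r') _ (measurable_cst _))//;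
    last by move=> w _; rewrite lee_fin.
  by congr (_ + _)%E; symmetry; exact: integral_probability_cst.
apply: ge0_le_integral => //.
- by move=> w _; rewrite lee_fin excess_ge0.
- by apply: emeasurable_funD.
- move=> w _; rewrite /= -EFinD lee_fin /excess.
  rewrite (distrC r r'); have := ler_norm (r' - r); have := normr_ge0 (r' - r).
  case: (leP (X z 0%N w - r) 0); case: (leP (X z 0%N w - r') 0); lra.
Qed.

(** Intermediate values: rewards being nonnegative, the mean excess at -a is at least a, while it is
    0 at [reward_bound z]. The bound on r will dominate [Wstar] in the main layer. *)
Lemma mean_excess_root z : exists2 r, r <= reward_bound z & mean_excess z r = a%:E.
Proof.
have fE r : mean_excess z r = (fine (mean_excess z r))%:E.
  by rewrite fineK ?mean_excess_fin.
have cf : continuous (fun r : R => fine (mean_excess z r)).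
  move=> r; apply/cvgrPdist_le => e e0; near=> r'.
  have close : `|r - r'| <= e by near: r'; exact: cvgr_dist_le.
  have lip (x y : R) : fine (mean_excess z x) - fine (mean_excess z y) <= `|x - y|.
    by rewrite lerBlDl -lee_fin EFinD -!fE; exact: mean_excess_lipschitz.
  apply: le_trans close; rewrite ler_norml lip andbT lerNl opprB.
  by rewrite [leRHS]distrC; exact: lip.
have rle : - a <= reward_bound z.
  by apply: (@le_trans _ _ 0); rewrite ?reward_bound_ge0// oppr_le0 ltW.
have lo : a <= fine (mean_excess z (- a)).
  rewrite -lee_fin -fE -(integral_probability_cst Q a).
  apply: ge0_le_integral => //.
  - by move=> w _; rewrite lee_fin ltW.
  - exact: (adapted_measurable obsm 0%N (adapted_excess z _)).
  - by move=> w _; rewrite lee_fin le_max opprK lerDr sub_reward_ge0.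
have hi : fine (mean_excess z (reward_bound z)) = 0.
  rewrite /mean_excess integral0_eq// => w _; congr EFin.
  by apply/max_idPr; rewrite subr_le0 sub_reward_le.
have [||r rI fr] := @IVT R (fun r => fine (mean_excess z r)) _ _ a rle.
- by apply: continuous_subspaceT => r; exact: cf.
- by rewrite hi ge_min le_max lo (ltW a_gt0) orbT.
- exists r; last by rewrite fE fr.
  by move: rI; rewrite in_itv /= => /andP[].
Unshelve. all: by end_near.
Qed.

Lemma mean_excess_le z r r' : r <= r' -> (mean_excess z r' <= mean_excess z r)%E.
Proof.
move=> rr; apply: ge0_le_integral => //.
- by move=> w _; rewrite lee_fin excess_ge0.
- exact: (adapted_measurable obsm 0%N (adapted_excess z _)).
- exact: (adapted_measurable obsm 0%N (adapted_excess z _)).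
- move=> w _; rewrite lee_fin /excess.
  case: (leP (X z 0%N w - r') 0); case: (leP (X z 0%N w - r) 0); lra.
Qed.

(** The excess vanishes off the stopping event and is at most B on it, so a <= B Q(event); the
    summand 1 keeps B positive. *)
Lemma stop_prob_ge z r : mean_excess z r = a%:E ->
  exists2 delta : R, 0 < delta & forall m, (delta%:E <= Q [set w | (r <= X z m w)%R])%E.
Proof.
move=> za; pose B := reward_bound z + `|r| + 1.
have B0 : 0 < B by rewrite ltr_wpDl// addr_ge0 ?reward_bound_ge0.
exists (a / B) => [|m]; first by rewrite divr_gt0.
have mE : measurable [set w | r <= X z m w].
  have := @measurable_fun_le _ _ _ setT (cst r) (X z m) measurableT.
  rewrite setTI; apply => //.
  exact/measurable_EFinP/(adapted_measurable obsm m (adapted_sub_reward z)).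
have QE : Q [set w | r <= X z m w] \is a fin_num by exact: fin_num_measure.
suff : (a%:E <= Q [set w | (r <= X z m w)%R] * B%:E)%E.
  move=> aQ; rewrite -(fineK QE) lee_fin ler_pdivrMr//.
  by rewrite -lee_fin (EFinM (fine _)) fineK.
rewrite -za.
have -> : Q [set w | (r <= X z m w)%R] =
    (\int[Q]_w (\1_[set w | (r <= X z m w)%R] w)%:E)%E.
  by rewrite integral_indic// setIT.
rewrite -(mean_excessE z r m) muleC.
rewrite -ge0_integralZl//; last by rewrite lee_fin ltW.
  apply: ge0_le_integral => //.
  - by move=> w _; rewrite lee_fin excess_ge0.
  - exact: (adapted_measurable obsm m (adapted_excess z _)).
  - apply: emeasurable_funM => //.
    by apply/measurable_EFinP; exact: measurable_indic.
  - move=> w _; rewrite -EFinM lee_fin indicE /excess.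
    case: (leP (X z m w - r) 0) => [_|rX].
      by rewrite mulr_ge0 ?ler0n// ltW.
    rewrite mem_set/= ?mulr1; last by move: rX; rewrite subr_gt0 => /ltW.
    rewrite /B -addrA lerD ?sub_reward_le// -normrN.
    by apply: le_trans (ler_norm _) _; rewrite lerDl.
by apply/measurable_EFinP; exact: measurable_indic.
Qed.

(** Lowering r to x raises the excess by r - x on the event r <= X, which has positive probability.
    This strictness is what makes the root measurable in z. *)
Lemma mean_excess_ltr z r x : mean_excess z r = a%:E ->
  (a%:E < mean_excess z x)%E = (x < r).
Proof.
move=> za; apply/idP/idP => [ax|xr].
  by rewrite ltNge; apply: contraL ax => /(mean_excess_le z); rewrite za -leNgt.
rewrite -za lt_neqAle mean_excess_le ?ltW// andbT; apply/eqP => e.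
have mE y := adapted_measurable obsm 0%N (adapted_excess z y).
have [delta d0 dE] := stop_prob_ge za.
suff : (mean_excess z r + ((r - x) * delta)%:E <= mean_excess z x)%E.
  rewrite -e za -EFinD lee_fin gerDl leNgt => /negP; apply.
  by rewrite mulr_gt0 ?subr_gt0.
have mX : measurable [set w | r <= X z 0%N w].
  have := @measurable_fun_le _ _ _ setT (cst r) (X z 0%N) measurableT.
  rewrite setTI; apply => //.
  exact/measurable_EFinP/(adapted_measurable obsm 0%N (adapted_sub_reward z)).
pose E1 w := ((r - x)%:E * (\1_[set w | r <= X z 0%N w] w)%:E)%E.
have E10 w : (0 <= E1 w)%E.
  by rewrite /E1 -EFinM lee_fin mulr_ge0 ?ler0n// subr_ge0 ltW.
have mI : measurable_fun setT (fun w => (\1_[set w | r <= X z 0%N w] w : R)%:E).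
  by apply/measurable_EFinP; exact: measurable_indic.
have mE1 : measurable_fun setT E1 by exact: emeasurable_funM.
apply: (@le_trans _ _ (\int[Q]_w ((excess z r 0 w)%:E + E1 w))%E).
  rewrite ge0_integralD//; last by move=> w _; rewrite lee_fin excess_ge0.
  rewrite leeD2l// ge0_integralZl//; last by rewrite lee_fin subr_ge0 ltW.
  rewrite integral_indic// setIT EFinM; apply: lee_wpmul2l; last exact: dE.
  by rewrite lee_fin subr_ge0 ltW.
apply: ge0_le_integral => //.
- by move=> w _; rewrite adde_ge0// lee_fin excess_ge0.
- exact: emeasurable_funD.
- move=> w _; rewrite /E1 -EFinM -EFinD lee_fin indicE /excess.
  have [rX|Xr] := leP r (X z 0%N w); last first.
    rewrite memNset ?mulr0 ?addr0; last by move=> /=; apply/negP; rewrite -ltNge.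
    by rewrite (max_idPr _) ?le_max ?lexx ?orbT// subr_le0 ltW.
  rewrite mem_set// mulr1 (max_idPl _) ?subr_ge0// le_max; apply/orP; left.
  by rewrite addrA subrK.
Qed.

Let mk n : measurable_fun setT (fun w => (k n w)%:R : R).
Proof.
have [mk _] := layer_geometric layer n.
by move=> _ U mU; exact: (mk measurableT [set m | U m%:R]).
Qed.

Let mcost : adapted obs (slot_cost k (gamma * tau / 2)).
Proof. exact: adapted_slot_cost. Qed.

Let cost_ge0 n w : (0 <= slot_cost k (gamma * tau / 2) n w)%E.
Proof. by rewrite lee_fin mulr_ge0// ltW// divr_gt0// mulr_gt0. Qed.

Let elapsed_ge0 n w : (0 <= (elapsed T tau k n w)%:E)%E.
Proof.
rewrite lee_fin addr_ge0//; first by rewrite ltW// divr_gt0.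
by rewrite mulr_ge0 ?sumr_ge0// ltW// divr_gt0.
Qed.

Let at_elapsed_ge0 (M : Omega -> option nat) w :
  (0 <= at_time +oo (fun m => (elapsed T tau k m w)%:E) (M w))%E.
Proof. by case: (M w) => [n|] //=. Qed.

Let measurable_elapsed n : measurable_fun setT (fun w => (elapsed T tau k n w)%:E).
Proof.
apply/measurable_EFinP; apply: measurable_funD => //; apply: measurable_funM => //.
exact: measurable_sum.
Qed.

(** An identity in [\bar R]: at [None] both integrands are [+oo], so it can also be used to prove
    that a duration is finite. *)
Lemma sub_time_cost (M : Omega -> option nat) : stopping_time (past obs \o succn) M ->
  (gamma%:E * expected_sub_time T tau Q k M = c0%:E +
   \int[Q]_w at_time +oo (fun n => \sum_(i < n.+1) slot_cost k (gamma * tau / 2) i w)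
     (M w))%E.
Proof.
move=> sM; have mM n := stopping_measurable obsm n sM.
rewrite -(integral_probability_cst Q c0) -ge0_integralZl//; last 2 first.
- exact: (measurable_at_time _ measurable_elapsed mM).
- by rewrite lee_fin ltW.
rewrite -ge0_integralD//; last 3 first.
- by move=> w _; rewrite lee_fin ltW.
- by move=> w _; case: (M w) => [n|]//=; exact: sume_ge0.
- apply: (@measurable_at_time _ _ _ +oo%E
    (fun n w => \sum_(i < n.+1) slot_cost k (gamma * tau / 2) i w)%E) => // n.
  by apply: emeasurable_sum => i; exact: (adapted_measurable obsm).
apply: eq_integral => w _; case: (M w) => [n|] /=.
  by rewrite -EFinM elapsed_cost.
by rewrite gt0_muley ?lte_fin// addey.
Qed.

Lemma reward_at_ge0 z (M : Omega -> option nat) w :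
  (0 <= at_time 0 (fun m => (X z m w)%:E) (M w))%E.
Proof. by case: (M w) => //= n; rewrite lee_fin sub_reward_ge0. Qed.

Lemma reward_at_le z (M : Omega -> option nat) w :
  (at_time 0 (fun m => (X z m w)%:E) (M w) <= (reward_bound z)%:E)%E.
Proof.
by case: (M w) => [n|] /=; rewrite lee_fin ?sub_reward_le ?reward_bound_ge0.
Qed.

Lemma measurable_reward_at z (M : Omega -> option nat) :
  stopping_time (past obs \o succn) M ->
  measurable_fun setT (fun w => at_time 0 (fun m => (X z m w)%:E) (M w)).
Proof.
move=> sM; apply: (@measurable_at_time _ _ _ 0%E (fun m w => (X z m w)%:E)) => n.
  exact: (adapted_measurable obsm n (adapted_sub_reward z)).
exact: (stopping_measurable obsm n sM).
Qed.

Lemma expected_sub_reward_le z (M : Omega -> option nat) :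
  stopping_time (past obs \o succn) M ->
  (expected_sub_reward T Ps Pr Q s g z M <= (reward_bound z)%:E)%E.
Proof.
move=> sM; rewrite -(integral_probability_cst Q (reward_bound z)).
apply: ge0_le_integral => //.
- by move=> w _; exact: reward_at_ge0.
- exact: measurable_reward_at.
- by move=> w _; exact: reward_at_le.
Qed.

Lemma expected_sub_reward_fin z (M : Omega -> option nat) :
  stopping_time (past obs \o succn) M ->
  expected_sub_reward T Ps Pr Q s g z M \is a fin_num.
Proof.
move=> sM; rewrite ge0_fin_numE.
  by apply: le_lt_trans (expected_sub_reward_le z sM) _; rewrite ltry.
by apply: integral_ge0 => w _; exact: reward_at_ge0.
Qed.

Lemma sub_gainE z (M : Omega -> option nat) : sub_rule T tau Q s k g M ->
  expected_sub_gain T tau Ps Pr Q s k g gamma z M =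
  (expected_sub_reward T Ps Pr Q s g z M -
   gamma%:E * expected_sub_time T tau Q k M)%E.
Proof.
move=> [sM Mfin]; have mM n := stopping_measurable obsm n sM.
have mtime := measurable_at_time +oo%E measurable_elapsed mM.
rewrite /expected_sub_gain integralB//.
- by rewrite ge0_integralZl// lee_fin ltW.
- apply/integrableP; split; first exact: measurable_reward_at.
  under eq_integral do rewrite gee0_abs ?reward_at_ge0//.
  by rewrite -ge0_fin_numE ?expected_sub_reward_fin// integral_ge0// => w _;
    exact: reward_at_ge0.
- apply: integrableZl => //; apply/integrableP; split => //.
  by under eq_integral do rewrite gee0_abs//.
Qed.

(* X <= excess + r, with r split into its positive and negative parts so that both
   sides are nonnegative. *)
Lemma excess_split z r m w :
  ((X z m w)%:E + (Num.max (- r) 0)%:E <= (excess z r m w)%:E + (Num.max r 0)%:E)%E /\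
  (r <= X z m w ->
   ((X z m w)%:E + (Num.max (- r) 0)%:E = (excess z r m w)%:E + (Num.max r 0)%:E)%E).
Proof.
rewrite -!EFinD lee_fin /excess; split; last move=> rX; last congr EFin.
  by case: (leP (- r) 0); case: (leP r 0); case: (leP (X z m w - r) 0); lra.
by case: (leP (- r) 0); case: (leP r 0); case: (leP (X z m w - r) 0); lra.
Qed.

Lemma max_opp_sub (r : R) : Num.max r 0 - Num.max (- r) 0 = r.
Proof. by case: (leP (- r) 0); case: (leP r 0); lra. Qed.

Let excess_cost z r : mean_excess z r = a%:E -> forall m,
  (\int[Q]_w (excess z r m w)%:E = \int[Q]_w slot_cost k (gamma * tau / 2) m w)%E.
Proof.
move=> za m; rewrite mean_excessE za (mean_slot_cost layer)//.
by rewrite ltW// divr_gt0// mulr_gt0.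
Qed.

Let excess0 z r m w : (0 <= (excess z r m w)%:E)%E.
Proof. by rewrite lee_fin excess_ge0. Qed.

Let at_excess0 z r (M : Omega -> option nat) w :
  (0 <= at_time 0 (fun m => (excess z r m w)%:E) (M w))%E.
Proof. by case: (M w) => //= n; rewrite lee_fin excess_ge0. Qed.

Let max0 (r : R) : (0 <= (Num.max r 0)%:E)%E.
Proof. by rewrite lee_fin le_max lexx orbT. Qed.

Let measurable_excess_at z r (M : Omega -> option nat) :
  stopping_time (past obs \o succn) M ->
  measurable_fun setT (fun w => at_time 0 (fun m => (excess z r m w)%:E) (M w)).
Proof.
move=> sM; apply: (@measurable_at_time _ _ _ 0%E (fun m w => (excess z r m w)%:E)) => n.
  exact: (adapted_measurable obsm n (adapted_excess z r)).
exact: (stopping_measurable obsm n sM).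
Qed.

Let gain_of (A I : \bar R) (r : R) : A \is a fin_num -> I \is a fin_num ->
  (A - (c0%:E + I) = A + (Num.max (- r) 0)%:E - (I + (Num.max r 0)%:E) + (r - c0)%:E)%E.
Proof.
move: A I => [x| |] [y| |] // _ _; rewrite -!(EFinD, EFinN); congr EFin.
by have := max_opp_sub r; lra.
Qed.

Lemma sub_gain_le z r (M : Omega -> option nat) : mean_excess z r = a%:E ->
  sub_rule T tau Q s k g M ->
  (expected_sub_gain T tau Ps Pr Q s k g gamma z M <= (r - c0)%:E)%E.
Proof.
move=> za rM; have [sM Mfin] := rM; have mM n := stopping_measurable obsm n sM.
have Mnone := at_time_lty_none measurable_elapsed elapsed_ge0 mM Mfin.
have Rfin := expected_sub_reward_fin z sM.
rewrite sub_gainE// (sub_time_cost sM).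
set A := expected_sub_reward _ _ _ _ _ _ _ _ in Rfin *.
set J := (\int[Q]_w at_time +oo _ _)%E.
have J0 : (0 <= J)%E.
  by apply: integral_ge0 => w _; case: (M w) => //= n; exact: sume_ge0.
have Jfin : J \is a fin_num.
  rewrite ge0_fin_numE//; apply: (@le_lt_trans _ _ (c0%:E + J)%E).
    by rewrite leeDr// lee_fin ltW.
  by rewrite -(sub_time_cost sM) lte_mul_pinfty// lee_fin ltW.
rewrite (gain_of r)// geeDr// sube_le0.
have XJ : (\int[Q]_w at_time 0 (fun m => (excess z r m w)%:E) (M w) <= J)%E.
  exact: (search_bound obsm obsi sM (adapted_excess z r) (excess0 z r) mcost
    cost_ge0 (excess_cost za)).
apply: (@le_trans _ _ (\int[Q]_w at_time 0 (fun m => (excess z r m w)%:E) (M w) +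
    (Num.max r 0)%:E)%E); last by rewrite leeD2r.
rewrite -(integral_probability_cst Q (Num.max r 0)).
rewrite -(integral_probability_cst Q (Num.max (- r) 0)).
have mA := measurable_reward_at z sM; have mX := measurable_excess_at z r sM.
rewrite -ge0_integralD//; last by move=> w _; exact: reward_at_ge0.
(* Only almost everywhere: on [None] the claim reads max(-r, 0) <= max(r, 0), false for negative r.
   Finite mean time makes that event null. *)
rewrite -ge0_integralD//; apply: ae_ge0_le_integral => //.
- by move=> w _; rewrite adde_ge0// reward_at_ge0.
- exact: emeasurable_funD.
- by move=> w _; rewrite adde_ge0.
- exact: emeasurable_funD.
- exists (M @^-1` [set None]); split => //; first exact: measurable_stop_None.
  move=> w /= Mw; case Mn : (M w) => [n|]//; exfalso; apply: Mw => _.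
  by rewrite Mn /=; have [] := excess_split z r n w.
Qed.

Definition threshold_rule z (r : R) (w : Omega) : option nat :=
  first_time (fun m => r <= X z m w).

Lemma obs_threshold z (r : R) n : <<s obs n >> [set w | r <= X z n w].
Proof.
have /measurable_EFinP mX := adapted_sub_reward z (n := n).
have := @measurable_fun_le _ _ _ setT (cst r : g_sigma_algebraType (obs n) -> R) _ measurableT
  (measurable_cst _) mX.
by rewrite setTI.
Qed.

Lemma threshold_rule_gain z r : mean_excess z r = a%:E ->
  sub_rule T tau Q s k g (threshold_rule z r) /\
  expected_sub_gain T tau Ps Pr Q s k g gamma z (threshold_rule z r) = (r - c0)%:E.
Proof.
move=> za; have [delta delta0 deltaE] := stop_prob_ge za.
set M := threshold_rule z r.
have sM : stopping_time (past obs \o succn) M.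
  exact: (stopping_first_time (obs_threshold z r)).
have mM n := stopping_measurable obsm n sM.
have XJ := search_first_time obsm obsi (obs_threshold z r) delta0 deltaE
  (adapted_excess z r) (excess0 z r) mcost cost_ge0 (excess_cost za).
have {XJ}/XJ XJ : forall m w, ~~ (r <= X z m w) -> (excess z r m w)%:E = 0%E.
  move=> m w; rewrite -ltNge => Xr; congr EFin.
  by apply/max_idPr; rewrite subr_le0 ltW.
have Xfin := at_time_first_time_lty obsm obsi (obs_threshold z r) delta0 deltaE
  (adapted_excess z r) (excess0 z r) (B := a).
have {Xfin}/Xfin Xfin : forall m, (\int[Q]_w (excess z r m w)%:E <= a%:E)%E.
  by move=> m; rewrite mean_excessE za.
rewrite -/(threshold_rule z r) -/M in XJ Xfin.
have Mnone : Q (M @^-1` [set None]) = 0%E.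
  exact: (first_time_infinite obsm obsi (obs_threshold z r) delta0 deltaE).
(* The priced time is c0 plus the mean excess at stopping, and the latter is finite by the geometric
   tail. *)
have rM : sub_rule T tau Q s k g M.
  split => //; have := sub_time_cost sM; rewrite -XJ => tE.
  rewrite ltey; apply: contraPN tE => /eqP ->.
  rewrite gt0_muley ?lte_fin// => /eqP; rewrite eq_sym.
  by apply/negP; rewrite -ltey; exact: lte_add_pinfty (ltry _) Xfin.
split=> //; rewrite sub_gainE// (sub_time_cost sM) -XJ.
set A := expected_sub_reward _ _ _ _ _ _ _ _.
have Afin : A \is a fin_num by exact: expected_sub_reward_fin.
set J := (\int[Q]_w at_time 0 _ _)%E in Xfin *.
have Jfin : J \is a fin_num.
  rewrite ge0_fin_numE//.
  by apply: integral_ge0 => w _; exact: (at_excess0 z r M w).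
rewrite (gain_of r)//.
suff -> : (A + (Num.max (- r) 0)%:E = J + (Num.max r 0)%:E)%E.
  by rewrite subee ?add0e// fin_numD Jfin.
rewrite -(integral_probability_cst Q (Num.max r 0)).
rewrite -(integral_probability_cst Q (Num.max (- r) 0)).
have mA := measurable_reward_at z sM; have mX := measurable_excess_at z r sM.
rewrite -ge0_integralD//; last by move=> w _; exact: reward_at_ge0.
have -> : J = (\int[Q]_w at_time 0 (fun m => (excess z r m w)%:E) (M w))%E by [].
rewrite -ge0_integralD//; apply: ge0_ae_eq_integral => //.
- exact: emeasurable_funD.
- exact: emeasurable_funD.
- by move=> w _; rewrite adde_ge0// reward_at_ge0.
- by move=> w _; rewrite adde_ge0.
- exists (M @^-1` [set None]); split => //; first exact: measurable_stop_None.
  move=> w /= Mw; case Mn : (M w) => [n|]//; exfalso; apply: Mw => _.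
  rewrite Mn /=; have [_] := excess_split z r n w; apply.
  by move: Mn; rewrite /M /threshold_rule => /first_time_some[].
Qed.

(** The supremum is attained by the threshold rule, so r - c0 is the root of the sub-layer
    equation. *)
Lemma Wstar_root z r : mean_excess z r = a%:E ->
  Wstar T tau Ps Pr Q s k g gamma z = (r - c0)%:E.
Proof.
move=> za; have [rM gM] := threshold_rule_gain za.
apply/eqP; rewrite eq_le; apply/andP; split.
  by apply: ub_ereal_sup => _ [M rM' <-]; exact: sub_gain_le.
by rewrite -gM; apply: ereal_sup_ubound; exists (threshold_rule z r).
Qed.

Lemma Mstar_root z r : mean_excess z r = a%:E ->
  Mstar T tau Ps Pr Q s k g gamma z = threshold_rule z r.
Proof.
move=> za; apply/funext => w; rewrite /Mstar (Wstar_root za) /threshold_rule.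
by congr first_time; apply/funext => m; rewrite -EFinD subrK lee_fin.
Qed.

Lemma sub_optimal z r : mean_excess z r = a%:E ->
  [/\ (0 <= Tbar T tau Ps Pr Q s k g gamma z < +oo)%E,
      Ybar T tau Ps Pr Q s k g gamma z =
        ((r - c0)%:E + gamma%:E * Tbar T tau Ps Pr Q s k g gamma z)%E &
      (Ybar T tau Ps Pr Q s k g gamma z <= (reward_bound z)%:E)%E].
Proof.
move=> za; rewrite /Tbar /Ybar (Mstar_root za).
have [rM gM] := threshold_rule_gain za; have [sM Mfin] := rM.
have T0 : (0 <= expected_sub_time T tau Q k (threshold_rule z r))%E.
  by apply: integral_ge0 => w _; exact: at_elapsed_ge0.
split; last exact: expected_sub_reward_le.
  by rewrite T0.
rewrite -gM sub_gainE// subeK// fin_numM// ge0_fin_numE//.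
Qed.

(** * Measurable dependence of the sub-layer solution on the main-layer gains *)

Section parametric.
Context {d1 : measure_display} {T1 : measurableType d1}.
Variables (z : T1 -> 'I_L -> R[i]) (r : T1 -> R).
Hypothesis mz : forall j, measurable_fun setT (fun t => normc (z t j)).
Hypothesis zr : forall t, mean_excess (z t) (r t) = a%:E.

Lemma measurable_sub_reward_pair m :
  measurable_fun setT (fun x : T1 * Omega => X (z x.1) m x.2).
Proof.
pose h (x : T1 * Omega) : T1 * g_sigma_algebraType (obs m) := (x.1, x.2).
have mid : measurable_fun setT h.
  apply: measurable_fun_pair; first exact: measurable_fst.
  move=> _ U mU; have := @measurable_snd _ _ T1 Omega measurableT U.
  by apply; exact: (s_obs_measurable obsm mU).
exact: (measurableT_comp (measurable_sub_reward (m := m) mz) mid).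
Qed.

(** By [mean_excess_ltr], r exceeds x exactly when the mean excess at x exceeds a, and that mean is
    a partial integral of a jointly measurable function. *)
Lemma measurable_root : measurable_fun setT r.
Proof.
apply: (measurability _ (RGenOInfty.measurableE R)).
move=> _ [_ [x ->] <-]; rewrite setTI.
have -> : r @^-1` [set` `]x, +oo[ ] = [set t | (a%:E < mean_excess (z t) x)%E].
  apply/seteqP; split => t /=; rewrite in_itv /= andbT;
    by rewrite (mean_excess_ltr x (zr t)).
pose F (y : T1 * Omega) : \bar R := (excess (z y.1) x 0 y.2)%:E.
have mF : measurable_fun setT F.
  apply/measurable_EFinP; apply: measurable_maxr => //.
  by apply: measurable_funB => //; exact: measurable_sub_reward_pair.
have F0 y : (0 <= F y)%E by rewrite lee_fin excess_ge0.
have := @measurable_fun_fubini_tonelli_F _ _ _ _ _ Q F mF F0.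
move=> /(emeasurable_fun_lt measurableT (measurable_cst a%:E)).
by rewrite setTI.
Qed.

Lemma measurable_Tbar :
  measurable_fun setT (fun t => Tbar T tau Ps Pr Q s k g gamma (z t)).
Proof.
pose N (x : T1 * Omega) := threshold_rule (z x.1) (r x.1) x.2.
pose F (x : T1 * Omega) : \bar R :=
  at_time +oo (fun m => (elapsed T tau k m x.2)%:E) (N x).
have mF : measurable_fun setT F.
  apply: (measurable_at_time +oo%E (X := fun m x => (elapsed T tau k m x.2)%:E)).
    by move=> n; exact: (measurableT_comp (measurable_elapsed n) measurable_snd).
  move=> n; apply: measurable_first_time => m.
  have := measurable_fun_le measurableT
    (measurableT_comp measurable_root measurable_fst) (measurable_sub_reward_pair m).
  by rewrite setTI.
have F0 x : (0 <= F x)%E by exact: at_elapsed_ge0.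
have := @measurable_fun_fubini_tonelli_F _ _ _ _ _ Q F mF F0.
rewrite (_ : fubini_F Q F = fun t => Tbar T tau Ps Pr Q s k g gamma (z t))//.
by apply/funext => t; rewrite /Tbar (Mstar_root (zr t)).
Qed.

End parametric.

End sublayer.

(** * The main layer *)

Section main_layer.
Context {R : realType} {d : measure_display} {Omega : measurableType d}.
Variables (T tau : R) (K L : nat) (P : probability Omega R) (p v : R).
Variables (s : nat -> Omega -> 'I_K) (k : nat -> Omega -> nat)
  (f : nat -> 'I_K * 'I_L -> Omega -> R[i]) (gamma : R).
Hypotheses (T_gt0 : 0 < T) (tau_gt0 : 0 < tau) (p_gt0 : 0 < p) (v_gt0 : 0 < v)
  (gamma_gt0 : 0 < gamma).
Hypothesis layer : contention_layer P p v s k f.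
Local Notation normc := ComplexField.Normc.normc.

Let c (j : 'I_L) (i : 'I_K) := (i, j).
Let obs := observation s k f c.
Let obsm := observation_measurable layer (c := c).
Let obsi := observation_independent layer (c := c).
Let gains := winner_gains s f.

Let c0 := T / 2 * gamma.
Let a := gamma * tau / 2 / p.

Let a_gt0 : 0 < a. Proof. by rewrite !divr_gt0// mulr_gt0. Qed.
Let c0_gt0 : 0 < c0. Proof. by rewrite mulr_gt0// divr_gt0. Qed.

(** Abstract form of the sub-layer: [value] stands for the finite number [Wstar], [Y] and [D] for
    [Ybar] and [Tbar], and b for the slope of the reward bound. *)
Variables (value : ('I_L -> R[i]) -> R) (Y D : ('I_L -> R[i]) -> \bar R) (b : R).
Hypotheses (b_ge0 : 0 <= b)
  (value_le : forall z, value z <= b * \sum_(j < L) normc (z j))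
  (D_ge0 : forall z, (0 <= D z)%E)
  (Y_ge0 : forall z, (0 <= Y z)%E)
  (YE : forall z, Y z = ((value z)%:E + gamma%:E * D z)%E)
  (Y_le : forall z, (Y z <= (b * \sum_(j < L) normc (z j))%:E)%E)
  (obs_value : forall n,
    measurable_fun (T := g_sigma_algebraType (obs n)) setT (fun w => value (gains n w)))
  (obs_D : adapted obs (fun n w => D (gains n w)))
  (mean_gain : forall n,
    (\int[P]_w (Num.max (value (gains n w) - c0) 0)%:E = a%:E)%E).

Let gain n w : \bar R := (Num.max (value (gains n w) - c0) 0)%:E.
Let cost := slot_cost k (gamma * tau / 2).
Let bound n w := b * \sum_(j < L) normc (gains n w j).
(** The priced time at stopping, apart from the main-layer slots: c0 for the term T / 2, the rest
    for the sub-layer. *)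
Let residual n w : \bar R := (c0%:E + gamma%:E * D (gains n w))%E.

Let bound_ge0 n w : 0 <= bound n w.
Proof. by rewrite mulr_ge0// sumr_ge0// => j _; exact: normc_nonneg. Qed.

Let gain_ge0 n w : (0 <= gain n w)%E.
Proof. by rewrite lee_fin le_max lexx orbT. Qed.

Let cost_ge0 n w : (0 <= cost n w)%E.
Proof. by rewrite lee_fin mulr_ge0// ltW// divr_gt0// mulr_gt0. Qed.

Let residual_ge0 n w : (0 <= residual n w)%E.
Proof. by rewrite adde_ge0 ?mule_ge0// lee_fin ltW. Qed.

Let obs_gain : adapted obs gain.
Proof.
move=> n; apply/measurable_EFinP; apply: measurable_maxr => //.
by apply: measurable_funB => //; exact: obs_value.
Qed.

Let obs_cost : adapted obs cost.
Proof. exact: adapted_slot_cost. Qed.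

Let obs_bound : adapted obs (fun n w => (bound n w)%:E).
Proof.
move=> n; apply/measurable_EFinP; apply: measurable_funM => //.
apply: measurable_sum => j; apply: measurable_normc.
exact: (@measurable_winner _ _ _ _ _ s k f _ c n j).
Qed.

Let obs_residual : adapted obs residual.
Proof.
move=> n; apply: emeasurable_funD => //.
by apply: emeasurable_funM => //; exact: obs_D.
Qed.

Let gain_cost n : (\int[P]_w gain n w = \int[P]_w cost n w)%E.
Proof.
by rewrite mean_gain (mean_slot_cost layer)// ltW// divr_gt0// mulr_gt0.
Qed.

Let measurable_normc_gain n i : measurable_fun setT (fun w => normc (f n i w)).
Proof. by apply: measurable_normc; have [] := layer_gaussian layer n i. Qed.

(** All contenders are included, so that the mean follows by linearity without reference to the
    winner. *)
Let square_sum n w : R := \sum_(i : 'I_K * 'I_L) normc (f n i w) ^+ 2.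

Let measurable_square_sum n : measurable_fun setT (square_sum n).
Proof.
by apply: measurable_sum => i; apply: measurable_funX; exact: measurable_normc_gain.
Qed.

Let square_sum_ge0 n w : 0 <= square_sum n w.
Proof. by apply: sumr_ge0 => i _; exact: sqr_ge0. Qed.

(* AM-GM in each term: x <= x^2 / l + l. *)
Let bound_le_square (l : R) n w : 0 < l ->
  bound n w <= b / l * square_sum n w + b * #|{: 'I_K * 'I_L}|%:R * l.
Proof.
move=> l0; rewrite -[b / l * _]mulrA -[b * _ * l]mulrA -mulrDr ler_wpM2l//.
have amgm (x : R) : x <= l^-1 * x ^+ 2 + l.
  rewrite -(ler_pM2l l0) mulrDr mulVKf ?gt_eqF//; nra.
apply: (@le_trans _ _ (\sum_(j < L) normc (f n (s n w, j) w))); first by [].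
apply: (@le_trans _ _ (\sum_(i : 'I_K * 'I_L) normc (f n i w))).
  have -> : \sum_i normc (f n i w) = \sum_(i < K) \sum_(j < L) normc (f n (i, j) w).
    by rewrite pair_bigA /=; apply: eq_bigr => -[].
  rewrite [leRHS](bigD1 (s n w))//=.
  by rewrite lerDl; apply: sumr_ge0 => i _; apply: sumr_ge0 => j _; exact: normc_nonneg.
rewrite -[#|_|]sum1_card natr_sum mulr_suml /square_sum mulr_sumr -big_split/=.
by apply: ler_sum => i _; rewrite mul1r; exact: amgm.
Qed.

Let square_sum_mean : exists2 M : R, 0 <= M &
  forall n, (\int[P]_w (square_sum n w)%:E = M%:E)%E.
Proof.
have [M M0 gM] := complex_gaussian_second_moment P v_gt0.
exists (\sum_(i : 'I_K * 'I_L) M); first exact: sumr_ge0.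
move=> n; under eq_integral do rewrite -sumEFin.
rewrite ge0_integral_sum//; last 2 first.
- move=> i; apply/measurable_EFinP; apply: measurable_funX.
  exact: measurable_normc_gain.
- by move=> i w _; rewrite lee_fin sqr_ge0.
rewrite -sumEFin; apply: eq_bigr => i _; apply: gM.
exact: (layer_gaussian layer).
Qed.

Let stop n w : bool := (c0 <= value (gains n w)).

Let obs_stop n : <<s obs n >> [set w | stop n w].
Proof.
have := @measurable_fun_le _ _ _ setT (cst c0 : g_sigma_algebraType (obs n) -> R)
  _ measurableT (measurable_cst _) (@obs_value n).
by rewrite setTI.
Qed.

Let mstop n : measurable [set w | stop n w].
Proof. exact: (s_obs_measurable obsm (@obs_stop n)). Qed.

Let mindic n : measurable_fun setT (fun w => (\1_[set w | stop n w] w : R)%:E).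
Proof. by apply/measurable_EFinP; exact: measurable_indic (mstop n). Qed.

Lemma bound_mean_le (l M : R) n : 0 < l ->
  (\int[P]_w (square_sum n w)%:E = M%:E)%E ->
  (\int[P]_w (bound n w)%:E <=
   (b / l * M + b * #|{: 'I_K * 'I_L}|%:R * l)%:E)%E.
Proof.
move=> l0 sM; set e := b * _ * l.
have bl0 : 0 <= b / l by rewrite divr_ge0// ltW.
have e0 : 0 <= e by rewrite !mulr_ge0// ltW.
have msq : measurable_fun setT (fun w => (square_sum n w)%:E) by exact/measurable_EFinP.
rewrite EFinD EFinM -sM -(integral_probability_cst P e) -ge0_integralZl//; last first.
  by move=> w _; rewrite lee_fin.
rewrite -ge0_integralD//.
- apply: ge0_le_integral => //.
  + by move=> w _; rewrite lee_fin.
  + exact: (adapted_measurable obsm n obs_bound).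
  + by apply: emeasurable_funD => //; apply: emeasurable_funM.
  + by move=> w _; rewrite -EFinM -EFinD lee_fin bound_le_square.
- by move=> w _; rewrite -EFinM lee_fin mulr_ge0.
- exact: emeasurable_funM.
Qed.

(* The laws of the gains at different times are only compared through their second
   moments: gain n <= bound n on the stopping event, and AM-GM with l large leaves
   at least half of the mean gain to the probability of that event. *)
Lemma main_stop_prob : exists2 delta : R, 0 < delta &
  forall n, (delta%:E <= P [set w | stop n w])%E.
Proof.
have [M M0 sM] := square_sum_mean.
set q := b * #|{: 'I_K * 'I_L}|%:R.
have q0 : 0 <= q by rewrite mulr_ge0.
(* Chosen to give b M / l <= a / 2; the summand 1 keeps l positive even if b or M is 0. *)
pose l := 2 * b * M / a + 1.
have l0 : 0 < l.
  by apply: ltr_wpDl => //; apply: divr_ge0; [rewrite !mulr_ge0|exact: ltW].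
have small : b / l * M <= a / 2.
  rewrite mulrAC ler_pdivrMr// /l mulrDr mulr1.
  rewrite (_ : a / 2 * (2 * b * M / a) = b * M); last by field; rewrite gt_eqF.
  by rewrite lerDl divr_ge0// ltW.
have r0 : 0 < q * l + 1 by rewrite ltr_wpDl// mulr_ge0// ltW.
exists (a / 2 / (q * l + 1)) => [|n]; first by do 2!apply: divr_gt0 => //.
have PE : P [set w | stop n w] \is a fin_num by exact: fin_num_measure.
have msq : measurable_fun setT (fun w => (square_sum n w)%:E) by exact/measurable_EFinP.
have bl0 : 0 <= b / l by rewrite divr_ge0// ltW.
suff : (a%:E <= (b / l * M)%:E + (q * l + 1)%:E * P [set w | stop n w])%E.
  rewrite -(fineK PE) -EFinM -EFinD !lee_fin => aP.
  by rewrite ler_pdivrMr// [leRHS]mulrC; lra.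
rewrite -(mean_gain n) EFinM -(sM n) -ge0_integralZl//; last first.
  by move=> w _; rewrite lee_fin.
have -> : P [set w | stop n w] = (\int[P]_w (\1_[set w | stop n w] w)%:E)%E.
  by rewrite integral_indic// setIT.
rewrite -ge0_integralZl//; last by rewrite lee_fin ltW.
rewrite -ge0_integralD//.
- apply: ge0_le_integral => //.
  + by move=> w _; exact: gain_ge0.
  + exact: (adapted_measurable obsm n obs_gain).
  + by apply: emeasurable_funD; exact: emeasurable_funM.
  + move=> w _; rewrite -!EFinM -EFinD lee_fin indicE.
    have sq0 : 0 <= b / l * square_sum n w by rewrite mulr_ge0.
    have [vc|cv] := leP (value (gains n w) - c0) 0.
      by rewrite addr_ge0// mulr_ge0// ltW.
    rewrite mem_set ?mulr1; last by rewrite /stop /= -subr_ge0 ltW.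
    have := value_le (gains n w); have := bound_le_square n w l0.
    move=> sq vb; apply: (@le_trans _ _ (bound n w)).
      by rewrite lerBlDr; apply: le_trans vb _; rewrite lerDl ltW.
    by apply: le_trans sq _; rewrite -/q lerD2l lerDl.
- by move=> w _; rewrite -EFinM lee_fin mulr_ge0.
- exact: emeasurable_funM.
- by move=> w _; rewrite -EFinM lee_fin mulr_ge0// ltW.
- exact: emeasurable_funM.
Qed.

Let time (N : Omega -> option nat) := expected_main_time T tau P s k f D N.
Let reward (N : Omega -> option nat) := expected_main_reward P s f Y N.

Let elapsed_ge n w : T / 2 <= elapsed T tau k n w.
Proof. by rewrite lerDl mulr_ge0 ?sumr_ge0// ltW// divr_gt0. Qed.

Let mduration n :
  measurable_fun setT (fun w => D (gains n w) + (elapsed T tau k n w)%:E)%E.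
Proof.
apply: emeasurable_funD; first exact: (adapted_measurable obsm n obs_D).
apply/measurable_EFinP; apply: measurable_funD => //; apply: measurable_funM => //.
apply: measurable_sum => i; have [mk _] := layer_geometric layer i.
by move=> _ U mU; exact: (mk measurableT [set m | U m%:R]).
Qed.

Let duration_ge n w : ((T / 2)%:E <= D (gains n w) + (elapsed T tau k n w)%:E)%E.
Proof. by rewrite -[leLHS]add0e leeD// lee_fin. Qed.

Let T2_ge0 : (0 <= (T / 2)%:E)%E.
Proof. by rewrite lee_fin ltW// divr_gt0. Qed.

Let stopN (N : Omega -> option nat) :
  stopping_time (main_filtration s k f) N -> stopping_time (past obs \o succn) N.
Proof. by []. Qed.

(** Keeps the denominator of the throughput away from 0. *)
Lemma main_time_ge (N : Omega -> option nat) :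
  stopping_time (past obs \o succn) N -> ((T / 2)%:E <= time N)%E.
Proof.
move=> sN; have mN n := stopping_measurable obsm n sN.
rewrite -(integral_probability_cst P (T / 2)); apply: ge0_le_integral => //.
- exact: (measurable_at_time +oo%E mduration mN).
- by move=> w _; case: (N w) => [n|] //=; rewrite leey.
Qed.

Lemma main_time_cost (N : Omega -> option nat) :
  stopping_time (past obs \o succn) N ->
  (gamma%:E * time N = \int[P]_w at_time 0 (residual ^~ w) (N w) +
   \int[P]_w at_time +oo (fun n => \sum_(i < n.+1) cost i w) (N w))%E.
Proof.
move=> sN; have mN n := stopping_measurable obsm n sN.
rewrite -ge0_integralZl//; last 3 first.
- exact: (measurable_at_time +oo%E mduration mN).
- move=> w _; case: (N w) => [n|] //=.
  exact: le_trans (duration_ge n w).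
- by rewrite lee_fin ltW.
rewrite -ge0_integralD//; last 4 first.
- by move=> w _; case: (N w) => [n|] //=.
- apply: (measurable_at_time _ _ mN) => n.
  exact: (adapted_measurable obsm n obs_residual).
- by move=> w _; case: (N w) => [n|] //=; exact: sume_ge0.
- apply: (@measurable_at_time _ _ _ +oo%E
    (fun n w => \sum_(i < n.+1) cost i w)%E) => // n.
  by apply: emeasurable_sum => i; exact: (adapted_measurable obsm).
apply: eq_integral => w _; case: (N w) => [n|] /=.
  rewrite ge0_muleDr//; last by apply: le_trans (elapsed_ge n w); rewrite -lee_fin.
  by rewrite -EFinM elapsed_cost addeA [X in (X + _)%E]addeC.
by rewrite gt0_muley ?lte_fin// addey.
Qed.

Lemma gain_residual n w : (Y (gains n w) <= gain n w + residual n w)%E /\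
  (stop n w -> Y (gains n w) = gain n w + residual n w)%E.
Proof.
rewrite YE /gain /residual addeA -EFinD; split.
  by rewrite leeD2r// lee_fin -lerBlDr le_max lexx.
by rewrite /stop => cv; rewrite (max_idPl _) ?subr_ge0// subrK.
Qed.

Let measurable_at_zero (Z : nat -> Omega -> \bar R) N :
  stopping_time (past obs \o succn) N -> adapted obs Z ->
  measurable_fun setT (fun w => at_time 0 (Z ^~ w) (N w)).
Proof.
move=> sN aZ; apply: measurable_at_time => n.
  exact: (adapted_measurable obsm n aZ).
exact: (stopping_measurable obsm n sN).
Qed.

Let obs_Y : adapted obs (fun n w => Y (gains n w)).
Proof.
move=> n; rewrite (_ : (fun w => _) =
  fun w => ((value (gains n w))%:E + gamma%:E * D (gains n w))%E); last first.
  by apply/funext => w; rewrite YE.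
apply: emeasurable_funD; first by apply/measurable_EFinP; exact: obs_value.
by apply: emeasurable_funM => //; exact: obs_D.
Qed.

Let at_zero_ge0 (Z : nat -> Omega -> \bar R) (N : Omega -> option nat) w :
  (forall n w, 0 <= Z n w)%E -> (0 <= at_time 0 (Z ^~ w) (N w))%E.
Proof. by move=> Z0; case: (N w) => [n|] //=. Qed.

(** The residual occurs on both sides; [search_bound] compares the remaining gains and slot costs.
    On [None] the reward is 0, so rules that may never stop are covered. *)
Lemma main_reward_le (N : Omega -> option nat) :
  stopping_time (past obs \o succn) N -> (reward N <= gamma%:E * time N)%E.
Proof.
move=> sN; rewrite main_time_cost// addeC.
apply: (@le_trans _ _ (\int[P]_w at_time 0 (gain ^~ w) (N w) +
    \int[P]_w at_time 0 (residual ^~ w) (N w))%E); last first.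
  by rewrite leeD2r//; exact: (search_bound obsm obsi).
rewrite -ge0_integralD//; last 4 first.
- by move=> w _; exact: at_zero_ge0.
- exact: measurable_at_zero.
- by move=> w _; exact: at_zero_ge0.
- exact: measurable_at_zero.
apply: ge0_le_integral => //.
- by move=> w _; apply: (at_zero_ge0 (Z := fun n w => Y (gains n w))).
- exact: measurable_at_zero obs_Y.
- by apply: emeasurable_funD; exact: measurable_at_zero.
- move=> w _; case: (N w) => [n|] /=; last by rewrite adde0.
  by have [] := gain_residual n w.
Qed.

Let Nstar w := first_time (stop ^~ w).

(** The equality holds in [\bar R] before the duration is known to be finite. Finiteness is proved
    for the reward, through the moment bound and the geometric tail. *)
Lemma main_optimal_reward :
  (reward Nstar = gamma%:E * time Nstar)%E /\ (reward Nstar < +oo)%E.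
Proof.
have [delta delta0 deltaP] := main_stop_prob.
have sN : stopping_time (past obs \o succn) Nstar.
  exact: stopping_first_time obs_stop.
split.
  rewrite main_time_cost// addeC.
  rewrite -(search_first_time obsm obsi obs_stop delta0 deltaP obs_gain gain_ge0
    obs_cost cost_ge0 gain_cost); last first.
    move=> n w; rewrite /stop -ltNge => vc; congr EFin.
    by apply/max_idPr; rewrite subr_le0 ltW.
  rewrite -ge0_integralD//; last 4 first.
  - by move=> w _; exact: (@at_zero_ge0 gain Nstar w).
  - exact: (@measurable_at_zero gain Nstar).
  - by move=> w _; exact: (@at_zero_ge0 residual Nstar w).
  - exact: (@measurable_at_zero residual Nstar).
  apply: eq_integral => w _; rewrite -/(Nstar w).
  case Nw : (Nstar w) => [n|] /=; last by rewrite adde0.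
  have [_ ->//] := gain_residual n w.
  by move/first_time_some : Nw => [].
have [M M0 sM] := square_sum_mean.
apply: (@le_lt_trans _ _ (\int[P]_w at_time 0 (fun n => (bound n w)%:E) (Nstar w))%E).
  apply: ge0_le_integral => //.
  - by move=> w _; apply: (at_zero_ge0 (Z := fun n w => Y (gains n w))).
  - exact: measurable_at_zero obs_Y.
  - exact: measurable_at_zero obs_bound.
  - by move=> w _; case: (Nstar w) => [n|] //=; exact: Y_le.
apply: (at_time_first_time_lty obsm obsi obs_stop delta0 deltaP obs_bound).
  by move=> n w; rewrite lee_fin.
by move=> n; exact: (bound_mean_le ltr01 (sM n)).
Qed.

Lemma main_optimal :
  main_rule T tau P s k f D Nstar /\
  throughput T tau P s k f Y D Nstar =
    ereal_sup [set throughput T tau P s k f Y D N | N in main_rule T tau P s k f D].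
Proof.
have sN : stopping_time (past obs \o succn) Nstar.
  exact: stopping_first_time obs_stop.
have [rE rfin] := main_optimal_reward.
have rule : main_rule T tau P s k f D Nstar.
  (* An infinite mean duration would make the reward infinite by [rE]. *)
  split => //; rewrite ltey; apply: contraTN rfin => /eqP tE.
  by rewrite rE /time tE gt0_muley ?lte_fin// ltxx.
have time_real N : main_rule T tau P s k f D N ->
    exists2 t : R, 0 < t & time N = t%:E.
  move=> [sN' tfin]; have tge := main_time_ge (stopN sN').
  have tf : time N \is a fin_num.
    by rewrite ge0_fin_numE//; exact: le_trans tge.
  exists (fine (time N)); last by rewrite fineK.
  rewrite -lte_fin fineK//; apply: lt_le_trans tge.
  by rewrite lte_fin divr_gt0.
have thr : throughput T tau P s k f Y D Nstar = gamma%:E.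
  have [t t0 tE] := time_real _ rule.
  rewrite /throughput -/(reward Nstar) -/(time Nstar) rE tE inver gt_eqF//.
  by rewrite -!EFinM mulfK// gt_eqF.
split=> //; rewrite thr; apply/eqP; rewrite eq_le; apply/andP; split.
  by rewrite -thr; apply: ereal_sup_ubound; exists Nstar.
apply: ub_ereal_sup => _ [N rN <-]; have [t t0 tE] := time_real _ rN.
have := main_reward_le (stopN (proj1 rN)).
rewrite /throughput -/(reward N) -/(time N) tE -EFinM inver gt_eqF// => rle.
by rewrite lee_pdivrMr// -EFinM.
Qed.

End main_layer.

Lemma success_prob_gt0 (R : realType) (u : nat) (p : R) :
  (1 <= u)%N -> 0 < p -> p < 1 -> 0 < success_prob u p.
Proof.
by move=> u1 p0 p1; rewrite /success_prob !mulr_gt0 ?ltr0n ?exprn_gt0 ?subr_gt0.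
Qed.

Theorem theorem6 (R : realType) (K L : nat)
  (T tau Ps Pr sigmaf2 sigmag2 p0 p1 : R)
  (* main layer *)
  (d : measure_display) (Omega : measurableType d) (P : probability Omega R)
  (s : nat -> Omega -> 'I_K) (k : nat -> Omega -> nat)
  (f : nat -> 'I_K * 'I_L -> Omega -> R[i])
  (* sub-layer *)
  (d' : measure_display) (Omega' : measurableType d') (Q : probability Omega' R)
  (s' : nat -> Omega' -> 'I_L) (k' : nat -> Omega' -> nat)
  (g : nat -> 'I_L -> Omega' -> R[i])
  (gamma : R)
  (K_ge1 : (1 <= K)%N) (L_ge1 : (1 <= L)%N)
  (T_gt0 : 0 < T) (tau_gt0 : 0 < tau) (Ps_gt0 : 0 < Ps) (Pr_gt0 : 0 < Pr)
  (sigmaf2_gt0 : 0 < sigmaf2) (sigmag2_gt0 : 0 < sigmag2)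
  (p0_gt0 : 0 < p0) (p0_lt1 : p0 < 1) (p1_gt0 : 0 < p1) (p1_lt1 : p1 < 1)
  (main : contention_layer P (success_prob K p0) sigmaf2 s k f)
  (sub : contention_layer Q (success_prob L p1) sigmag2 s' k' g)
  (gamma_gt0 : 0 < gamma) :
  let W := Wstar T tau Ps Pr Q s' k' g gamma in
  let Y := Ybar T tau Ps Pr Q s' k' g gamma in
  let D := Tbar T tau Ps Pr Q s' k' g gamma in
  let gains := winner_gains s f in
  let rule := main_rule T tau P s k f D in
  let ratio := throughput T tau P s k f Y D in
  let Nstar := fun w =>
    first_time (fun n => ((T / 2 * gamma)%:E <= W (gains n w))%E) in
  (forall n, (\int[P]_w maxe (W (gains n w) - (T / 2 * gamma)%:E) 0)%E =
             (tau * gamma / (2 * success_prob K p0))%:E) ->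
  rule Nstar /\ ratio Nstar = ereal_sup [set ratio N | N in rule].
Proof.
move=> W Y D gains rule ratio Nstar meanW.
have ps0 := success_prob_gt0 K_ge1 p0_gt0 p0_lt1.
have pr0 := success_prob_gt0 L_ge1 p1_gt0 p1_lt1.
(* Roots are picked by choice for each gain vector; [measurable_root] applies to any such
   selection. *)
have rootP z := cid2 (mean_excess_root T_gt0 tau_gt0 Ps_gt0 Pr_gt0 pr0 gamma_gt0 sub z).
pose root z := s2val (rootP z).
have rootE z := s2valP' (rootP z).
have WE z : W z = (root z - T / 2 * gamma)%:E.
  exact: (Wstar_root T_gt0 tau_gt0 Ps_gt0 Pr_gt0 pr0 gamma_gt0 sub (rootE z)).
have opt z := sub_optimal T_gt0 tau_gt0 Ps_gt0 Pr_gt0 pr0 gamma_gt0 sub (rootE z).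
have c0 : 0 <= T / 2 * gamma by rewrite ltW// mulr_gt0// divr_gt0.
pose b := T / 2 * (2 * Num.sqrt Ps / ln 2).
have b0 : 0 <= b.
  apply: mulr_ge0; first by rewrite ltW// divr_gt0.
  by rewrite divr_ge0 ?mulr_ge0 ?sqrtr_ge0// ltW// ln2_pos.
(* The parameter space of the sub-layer results is [Omega] with the sigma-algebra of observation n
   alone; this yields adaptedness, not mere measurability. *)
have mgains n j : measurable_fun setT
    (fun w : g_sigma_algebraType (observation s k f (fun j i => (i, j)) n) =>
      ComplexField.Normc.normc (gains n w j)).
  apply: measurable_normc.
  exact: (@measurable_winner _ _ _ _ _ s k f _ (fun j i => (i, j)) n j).
have -> : Nstar = fun w =>
    first_time (fun n => T / 2 * gamma <= root (gains n w) - T / 2 * gamma).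
  apply/funext => w; congr first_time; apply/funext => n.
  by rewrite WE lee_fin.
apply: (@main_optimal _ _ _ T tau K L P _ sigmaf2 s k f gamma T_gt0 tau_gt0 ps0
  sigmaf2_gt0 gamma_gt0 main (fun z => root z - T / 2 * gamma) Y D b) => //.
- move=> z; rewrite lerBlDr; apply: le_trans (s2valP (rootP z)) _.
  by rewrite lerDl.
- by move=> z; have [/andP[]] := opt z.
- by move=> z; apply: integral_ge0 => w _; exact: reward_at_ge0.
- by move=> z; have [_ YE _] := opt z; exact: YE.
- by move=> z; have [] := opt z.
- move=> n; apply: measurable_funB => //.
  exact: (measurable_root T_gt0 tau_gt0 Ps_gt0 Pr_gt0 pr0 gamma_gt0 sub (mgains n)
    (fun w => rootE (gains n w))).
- move=> n.
  exact: (measurable_Tbar T_gt0 tau_gt0 Ps_gt0 Pr_gt0 pr0 gamma_gt0 sub (mgains n)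
    (fun w => rootE (gains n w))).
- move=> n; have <- : tau * gamma / (2 * success_prob K p0) =
      gamma * tau / 2 / success_prob K p0.
    by field; rewrite gt_eqF.
  rewrite -(meanW n); apply: eq_integral => w _.
  by rewrite WE -EFinB EFin_max.
Qed.
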